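(* Let $n\ge 2$ and let $\tau\in\mathbb{C}^*$ (a fixed value of $t^{1/n}$). Let $\operatorname{mon}_\infty(x)\in \mathrm{GL}_n(\mathbb{C})$, $x=(x_1,\dots,x_{n-1})\in\mathbb{C}^{n-1}$, be the topological monodromy at $z=\infty$ attached to the eigenvalues $q_j=\zeta_n^j\tau z^{1/n}$ ($\zeta_n=e^{2\pi i/n}$, $0\le j\le n-1$) and the Stokes data $x$. Then the monodromy space $$\mathcal{R}_n=\{(M,x)\ :\ x\in\mathbb{C}^{n-1},\ M\in \mathrm{GL}_n(\mathbb{C})/\mathbb{C}^*,\ M\,\operatorname{mon}_\infty(x)=\operatorname{mon}_\infty(x)\,M\}$$ is smooth, connected, quasi-projective, of dimension $2(n-1)$.
   Context: Let $V=\bigoplus_{j=0}^{n-1}\mathbb{C}e_j$ with $V_{q_j}=\mathbb{C}e_j$, and let the formal monodromy $\gamma$ act by $e_0\mapsto e_1\mapsto\cdots\mapsto e_{n-1}\mapsto(-1)^{n-1}e_0$. For $k\ne l$, let $y$ be a nonzero solution of $z\frac{dy}{dz}=q_k-q_l$; a real number $d$ is a singular direction for $q_k-q_l$ if $y(e^{2\pi i d}r)$ tends to $0$ with maximal speed for $r\to+\infty$; equivalently $(\zeta_n^k-\zeta_n^l)\,\tau\, e^{2\pi i d/n}$ is a negative real number. The Stokes matrix at $d$ is $\mathrm{St}_d=1+\sum m_{k,l}$, the sum being over the pairs $(k,l)$ such that $d$ is singular for $q_k-q_l$, where $m_{k,l}$ is a linear map $V\to V_{q_k}\to V_{q_l}\subset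 V$ (projection followed by an arbitrary linear map, so $e_k\mapsto$ multiple of $e_l$). The total number of free entries of the $\mathrm{St}_d$ with $d\in[0,1)$ is $n-1$, and these entries are the Stokes data $x=(x_1,\dots,x_{n-1})$. If $1>d_s>\cdots>d_1\ge0$ are the singular directions in $[0,1)$, then $\operatorname{mon}_\infty(x)=\gamma\circ\mathrm{St}_{d_s}\circ\cdots\circ\mathrm{St}_{d_1}$. The space $\mathcal{R}_n$ describes the analytic data (Stokes data at $0$ and $\infty$ and a link between the solution spaces, up to equivalence) of connections with eigenvalues the Galois orbit of $z^{-1/n}$ at $z=0$ and of $t^{1/n}z^{1/n}$ at $z=\infty$; after fixing one link, any other link is given by a matrix $M$ commuting with $\operatorname{mon}_\infty$, taken modulo scalars. *)

(* Defs.v *)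
From HB Require Import structures.
From mathcomp Require Import all_boot all_order all_algebra.
From mathcomp Require Import finmap complex mpoly.
From mathcomp Require Import boolp classical_sets functions cardinality.
From mathcomp Require Import reals topology trigo.

Set Implicit Arguments.
Unset Strict Implicit.
Unset Printing Implicit Defensive.

Import Order.TTheory GRing.Theory Num.Theory.
Local Open Scope classical_set_scope.
Local Open Scope ring_scope.

(* Varieties over an algebraically closed field K are treated classically, as  *)
(* topological spaces equipped with a sheaf of K-valued functions. The basic   *)
(* objects are subsets of A^m x P^(k-1), with the Zariski topology and the     *)
(* functions that are locally quotients of polynomials of the same degree in   *)
(* the projective coordinates; for m = 0 these are subsets of P^(k-1).         *)

Definition scaling_class (K : fieldType) (V : lmodType K) (v : V) : set V :=
  [set c *: v | c in [set c : K | c != 0]].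

(* The projective factor of a point is stored as the set of all its vectors of *)
(* homogeneous coordinates, so that equality of points is Leibniz equality.    *)
Record affproj (K : closedFieldType) (m k : nat) := AffProj {
  affine_part : 'rV[K]_m;
  proj_part : set 'rV[K]_k;
  proj_partP : exists2 v, v != 0 & proj_part = scaling_class v }.

Section Zariski.
Variables (K : closedFieldType) (m k : nat).
Implicit Types (F : {mpoly K[m + k]}) (z : affproj K m k).

Definition eval_at F (x : 'rV[K]_m) (v : 'rV[K]_k) : K :=
  F.@[fun i => row_mx x v 0 i].

(* homogeneous of degree e in the last k variables, no condition on the others *)
Definition proj_homog (e : nat) F : Prop :=
  {in msupp F, forall u : 'X_{1..m + k}, (\sum_(j < k) u (rshift m j))%N = e}.

Definition nonvanishing F : set (affproj K m k) :=
  [set z | forall v, proj_part z v -> eval_at F (affine_part z) v != 0].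

Definition principal_opens : set (set (affproj K m k)) :=
  [set U | exists e F, proj_homog e F /\ U = nonvanishing F].

End Zariski.

HB.instance Definition _ (K : closedFieldType) (m k : nat) :=
  gen_eqMixin (affproj K m k).
HB.instance Definition _ (K : closedFieldType) (m k : nat) :=
  gen_choiceMixin (affproj K m k).
HB.instance Definition _ (K : closedFieldType) (m k : nat) :=
  isSubBaseTopological.Build (affproj K m k) (@principal_opens K m k) id.

(* A function on the whole space is used as a representative of its germs:     *)
(* regular_at p f says that f is regular on some neighbourhood of p.           *)
Record funspace (K : closedFieldType) := FunSpace {
  fs_space :> topologicalType;
  regular_at : fs_space -> set (fs_space -> K) }.

Definition subvariety (K : closedFieldType) (m k : nat)
    (X : set (affproj K m k)) : funspace K :=
  @FunSpace K (set_type X) (fun p f => exists e (F G : {mpoly K[m + k]}),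
    [/\ proj_homog e F, proj_homog e G &
      \forall q \near p, forall v, proj_part (set_val q) v ->
        eval_at G (affine_part (set_val q)) v != 0 /\
        f q = eval_at F (affine_part (set_val q)) v
              / eval_at G (affine_part (set_val q)) v]).

Section FunSpaceTheory.
Variable K : closedFieldType.

Definition morphism (X Y : funspace K) (phi : X -> Y) : Prop :=
  continuous phi /\
  forall p f, regular_at (phi p) f -> regular_at p (f \o phi).

Definition isomorphic (X Y : funspace K) : Prop :=
  exists (phi : X -> Y) (psi : Y -> X),
    [/\ cancel phi psi, cancel psi phi, morphism phi & morphism psi].

Definition locally_closed (T : topologicalType) (A : set T) : Prop :=
  exists U C : set T, [/\ open U, closed C & A = U `&` C].

Definition quasi_projective (X : funspace K) : Prop :=
  exists (N : nat) (Y : set (affproj K 0 N.+1)),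
    locally_closed Y /\ isomorphic X (subvariety Y).

Definition irreducible_set (T : topologicalType) (Z : set T) : Prop :=
  Z !=set0 /\ forall A B : set T, closed A -> closed B ->
    Z `<=` A `|` B -> Z `<=` A \/ Z `<=` B.

(* Z_0 < Z_1 < ... < Z_d, irreducible closed and satisfying P *)
Definition irreducible_chain (T : topologicalType) (P : set (set T))
    (d : nat) (Z : nat -> set T) : Prop :=
  (forall i, (i <= d)%N -> [/\ closed (Z i), irreducible_set (Z i) & P (Z i)])
  /\ forall i, (i < d)%N -> Z i `<` Z i.+1.

Definition max_chain_length (T : topologicalType) (P : set (set T))
    (d : nat) : Prop :=
  (exists Z, irreducible_chain P d Z) /\
  forall e Z, irreducible_chain P e Z -> (e <= d)%N.

Definition krull_dim (T : topologicalType) (d : nat) : Prop :=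
  max_chain_length (@setT (set T)) d.

(* The Krull dimension of the local ring at p: its prime ideals correspond to  *)
(* the irreducible closed subsets through p.                                   *)
Definition local_dim (T : topologicalType) (p : T) (d : nat) : Prop :=
  max_chain_length [set Z : set T | Z p] d.

Section LocalRing.
Variables (X : funspace K) (p : X).

Definition in_max_ideal (f : X -> K) : Prop := regular_at p f /\ f p = 0.

Definition in_max_ideal_sq (f : X -> K) : Prop :=
  exists (r : nat) (g h : 'I_r -> X -> K),
    (forall j, in_max_ideal (g j) /\ in_max_ideal (h j)) /\
    \forall q \near p, f q = \sum_(j < r) g j q * h j q.

(* the classes of t_1, ..., t_d form a basis of m_p / m_p^2 *)
Definition cotangent_basis (d : nat) (t : 'I_d -> X -> K) : Prop :=
  (forall i, in_max_ideal (t i)) /\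
  forall f, in_max_ideal f ->
    exists! a : 'rV[K]_d,
      in_max_ideal_sq (fun q => f q - \sum_(i < d) a 0 i * t i q).

(* the local ring at p is regular *)
Definition smooth_at : Prop :=
  exists d : nat, local_dim p d /\ exists t : 'I_d -> X -> K, cotangent_basis t.

End LocalRing.

Definition smooth (X : funspace K) : Prop := forall p : X, smooth_at p.

End FunSpaceTheory.

Section Monodromy.
Variables (R : realType) (n : nat) (tau : R[i]).

(* e^(i a) *)
Definition cis (a : R) : R[i] := (cos a +i* sin a)%C.

Definition zeta : R[i] := cis (2 * pi / n%:R).

(* In R[i], z < 0 means that z is real and negative. *)
Definition singular_dir (d : R) (p : 'I_n * 'I_n) : Prop :=
  (zeta ^+ p.1 - zeta ^+ p.2) * tau * cis (2 * pi * d / n%:R) < 0.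

(* the singular directions in [0, 1[, in increasing order *)
Definition singular_dirs : seq R :=
  sort <=%R (fset_set [set d : R | 0 <= d < 1 /\ exists p, singular_dir d p]).

(* The positions (k, l) of the free entries of the St_d for d in [0, 1[. Each  *)
(* pair has at most one singular direction there, and there are n - 1 pairs;   *)
(* the i-th one in this list carries the parameter x_i.                        *)
Definition stokes_pairs : seq ('I_n * 'I_n) :=
  enum [pred p | `[< exists d : R, 0 <= d < 1 /\ singular_dir d p >]].

Definition stokes_entry (x : 'rV[R[i]]_(n.-1)) (p : 'I_n * 'I_n) : R[i] :=
  if insub (index p stokes_pairs) is Some i then x 0 i else 0.

(* Matrices act on column vectors: the coefficient of e_i in the image of e_j  *)
(* is the entry (i, j).                                                        *)
Definition formal_monodromy : 'M[R[i]]_n :=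
  \matrix_(i, j) if (j.+1 < n)%N then (i == j.+1 :> nat)%:R
                 else (-1) ^+ n.-1 * (i == 0 :> nat)%:R.

Definition stokes_matrix (d : R) (x : 'rV[R[i]]_(n.-1)) : 'M[R[i]]_n :=
  1%:M + \sum_(p | `[< singular_dir d p >])
           stokes_entry x p *: delta_mx p.2 p.1.

Definition mon_infty (x : 'rV[R[i]]_(n.-1)) : 'M[R[i]]_n :=
  formal_monodromy *m \prod_(d <- rev singular_dirs) stokes_matrix d x.

(* GL_n / C^* is the open subset of invertible classes in P(M_n), where M_n is *)
(* identified with row vectors of length n * n.                                *)
Definition monodromy_set : set (affproj R[i] n.-1 (n * n)) :=
  [set z | exists M : 'M[R[i]]_n,
    [/\ M \in unitmx, proj_part z = scaling_class (mxvec M) &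
        M *m mon_infty (affine_part z) = mon_infty (affine_part z) *m M]].

Definition monodromy_space : funspace R[i] := subvariety monodromy_set.

End Monodromy.

(* Main.v *)
Require Import Defs.
From HB Require Import structures.
From mathcomp Require Import all_boot all_order all_algebra perm.
From mathcomp Require Import finmap complex mpoly.
From mathcomp Require Import boolp classical_sets functions cardinality.
From mathcomp Require Import reals topology trigo.
From mathcomp Require Import ring lra zify.

(* The matrix [N(x) := mon_infty x] has a cyclic vector [e_r] that does not      *)
(* depend on [x]: numbering the indices cyclically from a suitable [r], the      *)
(* Stokes maps [m_(k,l)] with direction in [0, 1[ send [e_k] to an earlier       *)
(* vector, while [gamma] sends each [e_k] to +-[e_(k+1)]; hence the Krylov       *)
(* matrix [e_r, N e_r, ..., N^(n-1) e_r] is triangular up to a permutation. A    *)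
(* matrix commuting with [N(x)] is then a unique combination of                  *)
(* [1, N(x), ..., N(x)^(n-1)], and [(x, [a]) |-> (x, [sum_i a_i N(x)^i])]        *)
(* identifies the monodromy space with an open subset of A^(n-1) x P^(n-1),      *)
(* which is smooth, irreducible and of dimension 2(n-1). It is also locally      *)
(* closed in A^(n-1) x P^(n^2-1), so that the Segre embedding makes it           *)
(* quasi-projective.                                                             *)

Set Implicit Arguments.
Unset Strict Implicit.
Unset Printing Implicit Defensive.

Import Order.TTheory GRing.Theory Num.Theory.
Local Open Scope classical_set_scope.
Local Open Scope ring_scope.

(** * Polynomial functions *)

(** The cyclic vector reduces everything to a statement about a polynomial family [N] of matrices
    for which one fixed basis vector is cyclic. Its source is [singular_dir_start], a computation
    with arguments of complex numbers; [mon_infty_cyclic] turns it into a Krylov determinant that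
    vanishes for no [x]. By [commutant_krylov_comb] and [krylov_combK] the powers of [N x] form a
    basis of its commutant, so a point of the space is a pair of [x] and a class [a] in P^(n-1),
    restricted by the invertibility of the combination.

    Normalising one coordinate of [a] to 1 gives charts ([commutant_affine_chart]) that identify
    open pieces with principal open subsets of A^(2(n-1)). Smoothness and dimension are then local:
    the chart coordinates give a basis of the cotangent space ([chart_cotangent_basis]), a flag of
    coordinate subspaces gives a chain of full length ([chart_local_chain]), and counting
    polynomials of bounded degree forbids longer chains ([prime_chain_le]). Connectedness comes from
    irreducibility: the space is the continuous image of a principal open subset of the affine space
    of pairs (x, a) ([irreducible_closure_image]). Finally, invertibility is an open condition and
    commutation a closed one, so the space is locally closed in A^(n-1) x P^(n^2-1), and
    [locally_closed_quasi_projective] carries it into a projective space. *)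

Section PolynomialFunctions.
Variable K : closedFieldType.

(** Polynomials are handled as functions: closure properties and reductions are inductions on this
    predicate. [polyfun_mpoly] recovers a formal polynomial where degrees have to be counted. *)
Inductive polyfun (d : nat) : ('rV[K]_d -> K) -> Prop :=
| polyfun_cst c : polyfun (fun=> c)
| polyfun_coord i : polyfun (fun x => x 0 i)
| polyfunD f g : polyfun f -> polyfun g -> polyfun (fun x => f x + g x)
| polyfunM f g : polyfun f -> polyfun g -> polyfun (fun x => f x * g x).

(* Homogeneous of degree [e] in the second argument only. *)
Inductive bihomog (m k : nat) : nat -> ('rV[K]_m -> 'rV[K]_k -> K) -> Prop :=
| bihomog_cst c : bihomog 0 (fun _ _ => c)
| bihomog0 e : bihomog e (fun _ _ => 0)
| bihomog_affine i : bihomog 0 (fun x _ => x 0 i)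
| bihomog_proj j : bihomog 1 (fun _ v => v 0 j)
| bihomogD e f g : bihomog e f -> bihomog e g ->
    bihomog e (fun x v => f x v + g x v)
| bihomogM e1 e2 f g : bihomog e1 f -> bihomog e2 g ->
    bihomog (e1 + e2) (fun x v => f x v * g x v).

Lemma eq_polyfun d (f g : 'rV[K]_d -> K) : polyfun f -> f =1 g -> polyfun g.
Proof. by move=> pf /funext<-. Qed.

Lemma polyfun_sum d I (r : seq I) (P : pred I) (f : I -> 'rV[K]_d -> K) :
  (forall i, P i -> polyfun (f i)) -> polyfun (fun x => \sum_(i <- r | P i) f i x).
Proof.
move=> hf; elim: r => [|i r IH].
  by apply: (eq_polyfun (polyfun_cst _ 0)) => x; rewrite big_nil.
have [Pi|nPi] := boolP (P i).
  by apply: (eq_polyfun (polyfunD (hf i Pi) IH)) => x; rewrite big_cons Pi.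
by apply: (eq_polyfun IH) => x; rewrite big_cons (negbTE nPi).
Qed.

Lemma polyfun_prod d I (r : seq I) (P : pred I) (f : I -> 'rV[K]_d -> K) :
  (forall i, P i -> polyfun (f i)) -> polyfun (fun x => \prod_(i <- r | P i) f i x).
Proof.
move=> hf; elim: r => [|i r IH].
  by apply: (eq_polyfun (polyfun_cst _ 1)) => x; rewrite big_nil.
have [Pi|nPi] := boolP (P i).
  by apply: (eq_polyfun (polyfunM (hf i Pi) IH)) => x; rewrite big_cons Pi.
by apply: (eq_polyfun IH) => x; rewrite big_cons (negbTE nPi).
Qed.

Lemma polyfunX d e (f : 'rV[K]_d -> K) : polyfun f -> polyfun (fun x => f x ^+ e).
Proof.
move=> hf; elim: e => [|e IH]; first exact: polyfun_cst.
by apply: (eq_polyfun (polyfunM hf IH)) => x; rewrite exprS.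
Qed.

Lemma polyfun_comp d d' (f : 'rV[K]_d -> K) (g : 'rV[K]_d' -> 'rV[K]_d) :
  (forall i, polyfun (fun y => g y 0 i)) -> polyfun f -> polyfun (f \o g).
Proof.
move=> hg; elim=> [c|i|f1 f2 _ h1 _ h2|f1 f2 _ h1 _ h2].
- exact: (polyfun_cst _ c).
- exact: hg.
- exact: (polyfunD h1 h2).
- exact: (polyfunM h1 h2).
Qed.

Lemma polyfun_det d n (A : 'rV[K]_d -> 'M[K]_n) :
  (forall i j, polyfun (fun x => A x i j)) -> polyfun (fun x => \det (A x)).
Proof.
move=> hA; apply: polyfun_sum => s _.
by apply: polyfunM; [exact: polyfun_cst|apply: polyfun_prod].
Qed.

Lemma polyfun_mulmx d m n p (A : 'rV[K]_d -> 'M[K]_(m, n)) (B : 'rV[K]_d -> 'M[K]_(n, p)) :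
  (forall i j, polyfun (fun x => A x i j)) ->
  (forall i j, polyfun (fun x => B x i j)) ->
  forall i j, polyfun (fun x => (A x *m B x) i j).
Proof.
move=> hA hB i j.
apply: (@eq_polyfun _ (fun x => \sum_l A x i l * B x l j)) => [|x].
  by apply: polyfun_sum => l _; apply: polyfunM.
by rewrite mxE.
Qed.

Lemma polyfun_line d (f : 'rV[K]_d -> K) x w :
  polyfun f -> exists P : {poly K}, forall s, f (x + s *: w) = P.[s].
Proof.
elim=> [c|i|f1 f2 _ [P1 h1] _ [P2 h2]|f1 f2 _ [P1 h1] _ [P2 h2]].
- by exists c%:P => s; rewrite hornerC.
- by exists ((x 0 i)%:P + 'X * (w 0 i)%:P) => s; rewrite !hornerE !mxE.
- by exists (P1 + P2) => s; rewrite hornerD h1 h2.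
- by exists (P1 * P2) => s; rewrite hornerM h1 h2.
Qed.

(* Hadamard's lemma: the first-order Taylor formula with polynomial coefficients. *)
Lemma polyfun_taylor d (f : 'rV[K]_d -> K) (p : 'rV[K]_d) : polyfun f ->
  exists2 h : 'I_d -> 'rV[K]_d -> K, (forall i, polyfun (h i)) &
    forall y, f y = f p + \sum_i (y 0 i - p 0 i) * h i y.
Proof.
elim=> [c|i|f1 f2 pf1 [h1 p1 e1] pf2 [h2 p2 e2]|f1 f2 pf1 [h1 p1 e1] pf2 [h2 p2 e2]].
- exists (fun _ _ => 0) => [i|y]; first exact: polyfun_cst.
  by rewrite big1 ?addr0// => i _; rewrite mulr0.
- exists (fun j _ => (j == i)%:R) => [j|y]; first exact: polyfun_cst.
  rewrite (bigD1 i)//= eqxx mulr1 big1 ?addr0 => [|j /negbTE->]; last by rewrite mulr0.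
  by rewrite addrC subrK.
- exists (fun i y => h1 i y + h2 i y) => [i|y]; first exact: polyfunD.
  rewrite e1 e2 addrACA -big_split /=; congr (_ + _).
  by apply: eq_bigr => i _; rewrite mulrDr.
(* Product rule: f1 f2 - f1(p) f2(p) = (f1 - f1(p)) f2 + f1(p) (f2 - f2(p)). *)
- exists (fun i y => h1 i y * f2 y + f1 p * h2 i y) => [i|y].
    by apply: polyfunD; apply: polyfunM => //; exact: polyfun_cst.
  have -> : \sum_i (y 0 i - p 0 i) * (h1 i y * f2 y + f1 p * h2 i y) =
      (\sum_i (y 0 i - p 0 i) * h1 i y) * f2 y +
      f1 p * (\sum_i (y 0 i - p 0 i) * h2 i y).
    rewrite mulr_suml mulr_sumr -big_split; apply: eq_bigr => i _ /=; ring.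
  rewrite [in LHS]e1 mulrDl [X in f1 p * X + _ = _]e2; ring.
Qed.

Lemma eq_bihomog m k e (f g : 'rV[K]_m -> 'rV[K]_k -> K) :
  bihomog e f -> f =2 g -> bihomog e g.
Proof. by move=> hf h; have <- : f = g by apply/funext => x; apply/funext. Qed.

Lemma bihomog_sum m k e I (r : seq I) (P : pred I) (f : I -> 'rV[K]_m -> 'rV[K]_k -> K) :
  (forall i, P i -> bihomog e (f i)) ->
  bihomog e (fun x v => \sum_(i <- r | P i) f i x v).
Proof.
move=> hf; elim: r => [|i r IH].
  by apply: (eq_bihomog (bihomog0 _ _ e)) => x v; rewrite big_nil.
have [Pi|nPi] := boolP (P i).
  by apply: (eq_bihomog (bihomogD (hf i Pi) IH)) => x v; rewrite big_cons Pi.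
by apply: (eq_bihomog IH) => x v; rewrite big_cons (negbTE nPi).
Qed.

Lemma bihomog_prod m k I (r : seq I) (e : I -> nat) (f : I -> 'rV[K]_m -> 'rV[K]_k -> K) :
  (forall i, bihomog (e i) (f i)) ->
  bihomog (\sum_(i <- r) e i) (fun x v => \prod_(i <- r) f i x v).
Proof.
move=> hf; elim: r => [|i r IH].
  by rewrite big_nil; apply: (eq_bihomog (bihomog_cst _ _ 1)) => x v; rewrite big_nil.
rewrite big_cons; apply: (eq_bihomog (bihomogM (hf i) IH)) => x v.
by rewrite big_cons.
Qed.

Lemma bihomogX m k e a (f : 'rV[K]_m -> 'rV[K]_k -> K) :
  bihomog e f -> bihomog (a * e) (fun x v => f x v ^+ a).
Proof.
move=> hf; elim: a => [|a IH]; first exact: bihomog_cst.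
by rewrite mulSn; apply: (eq_bihomog (bihomogM hf IH)) => x v; rewrite exprS.
Qed.

Lemma bihomog_det m k n (A : 'rV[K]_m -> 'rV[K]_k -> 'M[K]_n) :
  (forall i j, bihomog 1 (fun x v => A x v i j)) ->
  bihomog n (fun x v => \det (A x v)).
Proof.
move=> hA; apply: bihomog_sum => s _.
have nE : (0 + \sum_(i < n) 1 = n)%N by rewrite sum1_card card_ord.
rewrite -[X in bihomog X _]nE; apply: bihomogM; first exact: bihomog_cst.
by apply: bihomog_prod => i; exact: hA.
Qed.

Lemma bihomog_polyfun m k (f : 'rV[K]_m -> K) :
  polyfun f -> bihomog 0 (fun x (_ : 'rV[K]_k) => f x).
Proof.
elim=> [c|i|f1 f2 _ h1 _ h2|f1 f2 _ h1 _ h2].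
- exact: bihomog_cst.
- exact: bihomog_affine.
- exact: bihomogD h1 h2.
- exact: bihomogM h1 h2.
Qed.

Lemma polyfun_bihomog m k d e (f : 'rV[K]_m -> 'rV[K]_k -> K)
    (A : 'rV[K]_d -> 'rV[K]_m) (B : 'rV[K]_d -> 'rV[K]_k) :
  (forall i, polyfun (fun y => A y 0 i)) ->
  (forall i, polyfun (fun y => B y 0 i)) ->
  bihomog e f -> polyfun (fun y => f (A y) (B y)).
Proof.
move=> hA hB; elim=> [c|_|i|j|e1 f1 f2 _ h1 _ h2|e1 e2 f1 f2 _ h1 _ h2] //.
- exact: polyfun_cst.
- exact: polyfun_cst.
- exact: polyfunD.
- exact: polyfunM.
Qed.

Lemma bihomogZ m k e (f : 'rV[K]_m -> 'rV[K]_k -> K) c x v :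
  bihomog e f -> f x (c *: v) = c ^+ e * f x v.
Proof.
elim=> [a|e1|i|j|e1 f1 f2 _ h1 _ h2|e1 e2 f1 f2 _ h1 _ h2].
- by rewrite mul1r.
- by rewrite mulr0.
- by rewrite mul1r.
- by rewrite mxE.
- by rewrite h1 h2 mulrDr.
- by rewrite h1 h2 exprD mulrACA.
Qed.

Lemma proj_homogD m k e (F G : {mpoly K[m + k]}) :
  proj_homog e F -> proj_homog e G -> proj_homog e (F + G).
Proof.
by move=> hF hG u /msuppD_le; rewrite mem_cat => /orP[/hF|/hG].
Qed.

Lemma proj_homogM m k e1 e2 (F G : {mpoly K[m + k]}) :
  proj_homog e1 F -> proj_homog e2 G -> proj_homog (e1 + e2) (F * G).
Proof.
move=> hF hG u /msuppM_le /allpairsP[[a b] /= [/hF ha /hG hb ->]].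
by rewrite -ha -hb -big_split; apply: eq_bigr => j _; rewrite mnmDE.
Qed.

(** Links the inductive predicate with [proj_homog]. For the converse, [F] is expanded into
    monomials, each of which has degree [e] in the last [k] variables. *)
Lemma bihomogP m k e (f : 'rV[K]_m -> 'rV[K]_k -> K) :
  bihomog e f <-> exists2 F : {mpoly K[m + k]}, proj_homog e F & f =2 eval_at F.
Proof.
split.
  elim=> [c|e1|i|j|e1 f1 f2 _ [F1 h1 E1] _ [F2 h2 E2]|e1 e2 f1 f2 _ [F1 h1 E1] _ [F2 h2 E2]].
  - exists c%:MP => [u|x v]; last by rewrite /eval_at mevalC.
    rewrite msuppC; case: ifP => // _; rewrite inE => /eqP->.
    by apply: big1 => j _; rewrite mnm0E.
  - by exists 0 => [u|x v]; [rewrite msupp0|rewrite /eval_at meval0].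
  - exists 'X_(lshift k i) => [u|x v]; last by rewrite /eval_at mevalXU row_mxEl.
    rewrite msuppX inE => /eqP->; apply: big1 => j _.
    by rewrite mnm1E eq_lrshift.
  - exists 'X_(rshift m j) => [u|x v]; last by rewrite /eval_at mevalXU row_mxEr.
    rewrite msuppX inE => /eqP->; rewrite (bigD1 j)//= mnm1E eqxx big1// => i ij.
    by rewrite mnm1E eq_rshift eq_sym (negbTE ij).
  - exists (F1 + F2) => [|x v]; first exact: proj_homogD.
    by rewrite /eval_at mevalD E1 E2.
  - exists (F1 * F2) => [|x v]; first exact: proj_homogM.
    by rewrite /eval_at mevalM E1 E2.
case=> F hF E.
pose g u (x : 'rV[K]_m) (v : 'rV[K]_k) :=
  F@_u * ((\prod_(i < m) x 0 i ^+ u (lshift k i)) * \prod_(j < k) v 0 j ^+ u (rshift m j)).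
apply: (@eq_bihomog _ _ _ (fun x v => \sum_(u <- msupp F) g u x v)); last first.
  move=> x v; rewrite E /eval_at mevalE; apply: eq_bigr => u _.
  rewrite big_split_ord/=; congr (_ * (_ * _)).
    by apply: eq_bigr => i _; rewrite row_mxEl.
  by apply: eq_bigr => i _; rewrite row_mxEr.
suff: forall s : seq 'X_{1..m + k}, {subset s <= msupp F} ->
    bihomog e (fun x v => \sum_(u <- s) g u x v) by apply.
elim=> [|u s IH] hs.
  by apply: (eq_bihomog (bihomog0 _ _ e)) => x v; rewrite big_nil.
apply: (@eq_bihomog _ _ _ (fun x v => g u x v + \sum_(u <- s) g u x v)); last first.
  by move=> x v; rewrite big_cons.
apply: bihomogD; last by apply: IH => w ws; apply: hs; rewrite inE ws orbT.
have <- : (0 + (0 + \sum_j u (rshift m j)))%N = e.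
  by rewrite !add0n; apply: hF; apply: hs; rewrite mem_head.
apply: bihomogM; first exact: bihomog_cst.
apply: bihomogM.
  apply: bihomog_polyfun; apply: polyfun_prod => i _; apply: polyfunX.
  exact: polyfun_coord.
apply: bihomog_prod => j.
by rewrite -[X in bihomog X]muln1; apply: bihomogX; exact: bihomog_proj.
Qed.

Lemma polyfun_mpoly d (f : 'rV[K]_d -> K) : polyfun f ->
  exists F : {mpoly K[d]}, forall x, f x = F.@[x 0].
Proof.
elim=> [c|i|f1 f2 _ [F1 h1] _ [F2 h2]|f1 f2 _ [F1 h1] _ [F2 h2]].
- by exists c%:MP => x; rewrite mevalC.
- by exists 'X_i => x; rewrite mevalXU.
- by exists (F1 + F2) => x; rewrite mevalD h1 h2.
- by exists (F1 * F2) => x; rewrite mevalM h1 h2.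
Qed.

End PolynomialFunctions.

(** * The Zariski topology *)

Section AffProjTopology.
Variables (K : closedFieldType) (m k : nat).
Implicit Types (z : affproj K m k).

Lemma scaling_class_id (v : 'rV[K]_k) : scaling_class v v.
Proof. by exists 1; rewrite /= ?oner_neq0 ?scale1r. Qed.

Lemma eq_scaling_class (v w : 'rV[K]_k) :
  scaling_class v w -> scaling_class w = scaling_class v.
Proof.
move=> [c /= c0 <-]; apply/seteqP; split=> u [d /= d0 <-].
  by exists (d * c); rewrite /= ?mulf_neq0// scalerA.
by exists (d / c); rewrite /= ?mulf_neq0 ?invr_eq0// scalerA divfK.
Qed.

Lemma proj_part_class z v : proj_part z v -> proj_part z = scaling_class v.
Proof. by have [w w0 E] := proj_partP z; rewrite E => /eq_scaling_class ->. Qed.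

Lemma proj_part_neq0 z v : proj_part z v -> v != 0.
Proof.
have [w w0 E] := proj_partP z; rewrite E => -[c /= c0 <-].
by rewrite scaler_eq0 negb_or c0.
Qed.

Lemma proj_part_ex z : exists v, proj_part z v.
Proof. by have [w w0 E] := proj_partP z; exists w; rewrite E; exact: scaling_class_id. Qed.

Lemma affproj_eq z1 z2 v : affine_part z1 = affine_part z2 ->
  proj_part z1 v -> proj_part z2 v -> z1 = z2.
Proof.
move=> + /proj_part_class + /proj_part_class.
case: z1 z2 => [x1 p1 P1] [x2 p2 P2] /= -> E1 E2.
by move: P1 P2; rewrite E1 E2 => P1 P2; congr AffProj; exact: Prop_irrelevance.
Qed.

Definition proj_point (x : 'rV[K]_m) (v : 'rV[K]_k) (hv : v != 0) : affproj K m k :=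
  AffProj x (ex_intro2 (fun w => w != 0) (fun w => scaling_class v = scaling_class w)
    v hv erefl).

Lemma bihomog_rep e f z v w : @bihomog K m k e f -> proj_part z v -> proj_part z w ->
  f (affine_part z) v != 0 -> f (affine_part z) w != 0.
Proof.
move=> hf /proj_part_class -> [c /= c0 <-] fv.
by rewrite (bihomogZ _ _ _ hf) mulf_neq0 ?expf_neq0.
Qed.

(** A product of two bihomogeneous functions is nonzero exactly where both are, so the principal
    opens are stable under finite intersections and the subbase is a base. *)
Lemma affproj_nbhsP z (A : set (affproj K m k)) :
  nbhs z A <-> exists e f v, [/\ bihomog e f, proj_part z v,
    f (affine_part z) v != 0 &
    forall z' v', proj_part z' v' -> f (affine_part z') v' != 0 -> A z'].
Proof.
rewrite nbhsE; split.
  case=> B [[D' DB <-] [C D'C Cz]] BA.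
  have [J JP E] := DB _ D'C.
  have {}CA : C `<=` A by move=> y Cy; apply: BA; exists C.
  suff: exists e f v, [/\ bihomog e f, proj_part z v, f (affine_part z) v != 0 &
    forall z' v', proj_part z' v' -> f (affine_part z') v' != 0 -> C z'].
    by case=> e [f [v [h1 h2 h3 h4]]]; exists e, f, v; split=> // z' v' a b; apply/CA/h4/b.
  rewrite -E in Cz *; have [v zv] := proj_part_ex z.
  have : forall s : seq (set (affproj K m k)), {subset s <= J} ->
      exists e f, [/\ bihomog e f, f (affine_part z) v != 0 &
    forall z' v', proj_part z' v' -> f (affine_part z') v' != 0 -> forall U, U \in s -> U z'].
    elim=> [|U s IH] hs.
      exists 0%N, (fun _ _ => 1); split => //; first exact: bihomog_cst.
      by rewrite oner_neq0.
    have /IH[e [f [h1 h2 h3]]] : {subset s <= J}.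
      by move=> y ys; apply: hs; rewrite inE ys orbT.
    have UJ : U \in J by apply: hs; rewrite mem_head.
    have := JP _ UJ; rewrite inE => -[e' [F [hF UE]]].
    have bF : bihomog e' (eval_at F) by apply/bihomogP; exists F.
    exists (e + e')%N, (fun x v => f x v * eval_at F x v); split=> //.
    - exact: bihomogM.
    - rewrite mulf_neq0//; have := Cz _ UJ; rewrite /= UE; exact.
    - move=> z' v' zv'; rewrite mulf_eq0 negb_or => /andP[f0 F0] V.
      rewrite inE => /orP[/eqP->|]; last exact: h3 zv' f0 _.
      by rewrite UE => w zw; exact: bihomog_rep bF zv' zw F0.
  case/(_ (enum_fset J)) => // e [f [h1 h2 h3]].
  by exists e, f, v; split=> // z' v' zv' f0 U UJ; exact: h3 zv' f0 _ UJ.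
case=> e [f [v [hf zv f0 hA]]].
have /bihomogP[F hF EF] := hf.
exists (nonvanishing F); last first.
  move=> y yF; have [w yw] := proj_part_ex y.
  by apply: (hA y w yw); rewrite EF; exact: yF.
split; last by move=> w zw; rewrite -EF; exact: bihomog_rep hf zv zw f0.
exists [set nonvanishing F]; last by rewrite bigcup_set1.
move=> _ ->; exists [fset (nonvanishing F)]%fset; last first.
  apply/seteqP; split=> y h; first by apply: (h (nonvanishing F)); rewrite /= inE.
  by move=> U /=; rewrite inE => /eqP->.
move=> U; rewrite in_fset1 => /eqP ->; rewrite inE; by exists e, F.
Qed.

Lemma open_nonvanishing e (f : 'rV[K]_m -> 'rV[K]_k -> K) : bihomog e f ->
  open [set z | exists2 v, proj_part z v & f (affine_part z) v != 0].
Proof.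
move=> bf; rewrite openE => z [v zv fv]; apply/affproj_nbhsP.
by exists e, f, v; split=> // z' v' zv' fv'; exists v'.
Qed.

End AffProjTopology.

(** * Neighbourhoods and regular functions on a subvariety *)

Section Subvariety.
Variables (K : closedFieldType) (m k : nat) (X : set (affproj K m k)).
Implicit Types (p q : subvariety X).

Lemma subvariety_inj p q : set_val p = set_val q -> p = q.
Proof. exact: val_inj. Qed.

Lemma subvariety_nbhsP p (A : set (subvariety X)) :
  nbhs p A <-> exists e f v, [/\ bihomog e f, proj_part (set_val p) v,
    f (affine_part (set_val p)) v != 0 &
    forall q v', proj_part (set_val q) v' ->
      f (affine_part (set_val q)) v' != 0 -> A q].
Proof.
split.
  rewrite nbhsE => -[_ [[C oC <-]] Cp CA].
  have /affproj_nbhsP[e [f [v [h1 h2 h3 h4]]]] : nbhs (set_val p) C.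
    by apply: open_nbhs_nbhs.
  exists e, f, v; split=> // q v' a b; apply: CA; exact: h4 a b.
case=> e [f [v [h1 h2 h3 h4]]].
have : nbhs (set_val p) [set z | forall v', proj_part z v' -> f (affine_part z) v' != 0].
  apply/affproj_nbhsP; exists e, f, v; split=> // z' v' a b w zw.
  exact: bihomog_rep h1 a zw b.
rewrite [in X in X -> _]nbhsE => -[C [oC Cp] CA].
rewrite nbhsE; exists (set_val @^-1` C); first by split=> //; exists C.
move=> q /CA /= hq; have [w qw] := proj_part_ex (set_val q).
exact: h4 qw (hq _ qw).
Qed.

(** Multiplying numerator and denominator by the function that cuts out the neighbourhood makes the
    formula valid wherever the denominator is nonzero. *)
Lemma regular_atP p (f : subvariety X -> K) :
  regular_at p f <-> exists e F G v, [/\ bihomog e F, bihomog e G,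
    proj_part (set_val p) v, G (affine_part (set_val p)) v != 0 &
    forall q v', proj_part (set_val q) v' ->
      G (affine_part (set_val q)) v' != 0 ->
      f q = F (affine_part (set_val q)) v' / G (affine_part (set_val q)) v'].
Proof.
split.
  case=> e [F [G [hF hG]]] /subvariety_nbhsP[e' [h [v [h1 h2 h3 h4]]]].
  have bF : bihomog e (eval_at F) by apply/bihomogP; exists F.
  have bG : bihomog e (eval_at G) by apply/bihomogP; exists G.
  exists (e + e')%N, (fun x v => eval_at F x v * h x v), (fun x v => eval_at G x v * h x v), v.
  split=> //; try exact: bihomogM.
    by rewrite mulf_neq0//; have [] := h4 _ _ h2 h3 _ h2.
  move=> q v' qv'; rewrite mulf_eq0 negb_or => /andP[G0 h0].
  have [_ ->] := h4 _ _ qv' h0 _ qv'.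
  by rewrite -mulf_div divff// mulr1.
case=> e [f1 [g1 [v [/bihomogP[F hF EF] /bihomogP[G hG EG] pv G0 h]]]].
exists e, F, G; split=> //.
have bG : bihomog e (eval_at G) by apply/bihomogP; exists G.
apply/subvariety_nbhsP; exists e, (eval_at G), v; split=> //; first by rewrite -EG.
move=> q v' qv' G0' w qw; have G0w := bihomog_rep bG qv' qw G0'.
by split=> //; rewrite (h q w qw) EG// EF.
Qed.

End Subvariety.

(** * Dimension *)

Section ChainBound.
Variables (K : closedFieldType) (d : nat).
Implicit Types (W : set 'rV[K]_d).

(** [r] is a lower bound for the Hilbert function of [W] at [N]: [msize] at most [N.+1] means degree
    at most [N], and independence is that of the restrictions to [W]. *)
Definition indep_family W (N r : nat) : Prop :=
  exists phi : 'I_r -> {mpoly K[d]}, (forall j, (msize (phi j) <= N.+1)%N) /\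
    forall c : 'I_r -> K,
      (forall y, W y -> \sum_j c j * (phi j).@[y 0] = 0) -> forall j, c j = 0.

Lemma indep_family1 W N : W !=set0 -> indep_family W N 1.
Proof.
case=> y Wy; exists (fun=> 1); split=> [j|c /(_ y Wy)]; first by rewrite msize1.
by rewrite big_ord1 meval1 mulr1 => c0 j; rewrite ord1.
Qed.

Lemma card_bmultinom_le N : (#|{: 'X_{1..d < N.+1}}| <= N.+1 ^ d)%N.
Proof.
have -> : (N.+1 ^ d = #|{: {ffun 'I_d -> 'I_N.+1}}|)%N.
  by rewrite card_ffun !card_ord.
apply: (@leq_card _ _ (fun m : 'X_{1..d < N.+1} => [ffun i => inord (m i) : 'I_N.+1])).
move=> m1 m2 /ffunP E; apply/val_inj/mnmP => i.
have mN (m : 'X_{1..d < N.+1}) : (m i < N.+1)%N.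
  by apply: leq_ltn_trans (bmdeg m); rewrite mdegE (bigD1 i)//= leq_addr.
by have := E i; rewrite !ffunE => /(congr1 (@nat_of_ord _)); rewrite !inordK ?mN.
Qed.

(** More polynomials than monomials of degree at most [N] satisfy a linear relation, read off from
    the kernel of their coefficient matrix. *)
Lemma indep_family_le W N r : indep_family W N r -> (r <= N.+1 ^ d)%N.
Proof.
case=> phi [hs hi]; apply: leq_trans (card_bmultinom_le N); rewrite leqNgt.
apply/negP => lt_r.
pose A := \matrix_(j < r, a < #|{: 'X_{1..d < N.+1}}|) (phi j)@_(enum_val a).
have /rowV0Pn[v /sub_kermxP vA v0] : kermx A != 0.
  rewrite -mxrank_eq0 mxrank_ker -lt0n subn_gt0.
  exact: leq_ltn_trans (rank_leq_col _) lt_r.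
have E : \sum_j v 0 j *: phi j = 0.
  apply/mpolyP => m; rewrite mcoeff0 raddf_sum/=.
  have [ms|ms] := ltnP (mdeg m) N.+1; last first.
    rewrite big1// => j _; rewrite mcoeffZ memN_msupp_eq0 ?mulr0//.
    apply/negP => /msize_mdeg_lt; rewrite ltnNge; apply/negP/negPn.
    exact: leq_trans ms.
  have := congr1 (fun B : 'rV__ => B 0 (enum_rank (BMultinom ms))) vA.
  rewrite !mxE => E; rewrite -[RHS]E; apply: eq_bigr => j _.
  by rewrite mcoeffZ !mxE enum_rankK.
have : v = 0.
  apply/rowP => j; rewrite mxE; apply: (hi (fun j => v 0 j)) => y _.
  have := congr1 (meval (y 0)) E; rewrite meval0 raddf_sum/= => E'; rewrite -[RHS]E'.
  by apply: eq_bigr => i _; rewrite mevalZ.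
by move/eqP; rewrite (negbTE v0).
Qed.

(** The products of [F] with the family on [W'] vanish on [W], where the other family is
    independent. Restricting a relation to [W] kills the coefficients of the second block; then [F],
    not being a zero divisor on [W'], can be cancelled. *)
Lemma indep_family_step (W W' : set 'rV[K]_d) (F : {mpoly K[d]}) N D r r' :
  (W `<=` W') -> (msize F <= D.+1)%N ->
  (forall y, W y -> F.@[y 0] = 0) ->
  (forall H : {mpoly K[d]}, (forall y, W' y -> F.@[y 0] * H.@[y 0] = 0) ->
     forall y, W' y -> H.@[y 0] = 0) ->
  indep_family W (N + D) r -> indep_family W' N r' ->
  indep_family W' (N + D) (r' + r).
Proof.
move=> WW' sF F0 Freg [phi [sphi iphi]] [chi [schi ichi]].
pose xi (j : 'I_(r' + r)) := match fintype.split j with inl a => F * chi a | inr b => phi b end.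
have xil a : xi (lshift r a) = F * chi a.
  by rewrite /xi; case: split_ordP => ? /eqP; rewrite ?eq_lshift ?eq_lrshift// => /eqP<-.
have xir b : xi (rshift r' b) = phi b.
  by rewrite /xi; case: split_ordP => ? /eqP; rewrite ?eq_rshift ?eq_rlshift// => /eqP<-.
exists xi; split=> [j|c hc].
  rewrite /xi; case: fintype.split => [a|b]; last exact: sphi.
  have [->|nF] := eqVneq F 0; first by rewrite mul0r msize0.
  have [->|nc] := eqVneq (chi a) 0; first by rewrite mulr0 msize0.
  rewrite msizeM// -subn1 leq_subLR; apply: (leq_trans (leq_add sF (schi a))); lia.
have sumE y : \sum_j c j * (xi j).@[y 0] =
    F.@[y 0] * (\sum_a c (lshift r a) * (chi a).@[y 0]) +
    \sum_b c (rshift r' b) * (phi b).@[y 0].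
  rewrite big_split_ord/=; congr (_ + _); last by apply: eq_bigr => b _; rewrite xir.
  by rewrite mulr_sumr; apply: eq_bigr => a _; rewrite xil mevalM mulrCA.
have cr b : c (rshift r' b) = 0.
  apply: (iphi (fun b => c (rshift r' b))) => y Wy.
  by have := hc y (WW' _ Wy); rewrite sumE F0// mul0r add0r.
have cl a : c (lshift r a) = 0.
  apply: (ichi (fun a => c (lshift r a))) => y Wy.
  pose H := \sum_a c (lshift r a) *: chi a.
  have HE z : H.@[z 0] = \sum_a c (lshift r a) * (chi a).@[z 0].
    by rewrite raddf_sum; apply: eq_bigr => b _ /=; rewrite mevalZ.
  rewrite -HE; apply: Freg Wy => z Wz; rewrite HE -[RHS](hc z Wz) sumE.
  by rewrite [X in _ + X]big1 ?addr0// => b _; rewrite cr mul0r.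
by move=> j; rewrite -(fintype.splitK j); case: fintype.split => [a|b] /=; [exact: cl|exact: cr].
Qed.

Lemma expn_le_ffact N m : (N.+1 ^ m <= (N + m) ^_ m)%N.
Proof.
elim: m => [|m IH]; first by rewrite ffactn0.
by rewrite addnS ffactnS/= expnS leq_mul// ltnS leq_addr.
Qed.

(* If [e > d], the functions defining the steps of the chain produce, in degree *)
(* at most [N * D], at least 'C(N + d.+1, d.+1) independent polynomials in [d]  *)
(* variables, which is too many for large [N].                                  *)
Lemma prime_chain_le (e : nat) (W : nat -> set 'rV[K]_d) :
  W 0 !=set0 ->
  (forall i, (i < e)%N -> W i `<=` W i.+1) ->
  (forall i, (i <= e)%N -> forall F H, polyfun F -> polyfun H ->
     (forall y, W i y -> F y * H y = 0) ->
     (forall y, W i y -> F y = 0) \/ (forall y, W i y -> H y = 0)) ->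
  (forall i, (i < e)%N -> exists F, [/\ polyfun F, (forall y, W i y -> F y = 0) &
     ~ (forall y, W i.+1 y -> F y = 0)]) ->
  (e <= d)%N.
Proof.
move=> W0 WS Wprime Wstep; rewrite leqNgt; apply/negP => lt_de.
have {}Wstep i : exists F : {mpoly K[d]}, (i < e)%N ->
    (forall y, W i y -> F.@[y 0] = 0) /\
    forall H : {mpoly K[d]}, (forall y, W i.+1 y -> F.@[y 0] * H.@[y 0] = 0) ->
     forall y, W i.+1 y -> H.@[y 0] = 0.
  have [ie|_] := ltnP i e; last by exists 0.
  have [f [pf fv fnv]] := Wstep i ie.
  have [F EF] := polyfun_mpoly pf.
  exists F => _; split=> [y Wy|H hH]; first by rewrite -EF; exact: fv.
  have [] // := Wprime i.+1 ie f (fun y => H.@[y 0]) pf.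
  - apply: (@eq_polyfun _ _ (fun y => \sum_(m <- msupp H) H@_m * \prod_i y 0 i ^+ m i)).
      apply: polyfun_sum => m _; apply: polyfunM; first exact: polyfun_cst.
      by apply: polyfun_prod => l _; apply: polyfunX; exact: polyfun_coord.
    by move=> y; rewrite mevalE.
  - by move=> y Wy; rewrite EF; exact: hH.
have [F hF] := choice Wstep.
(* The successor makes [D] positive, as the final estimate [c * D + 1 <= D * (c + 1)] requires. *)
pose D := (\max_(i < e) msize (F i)).+1.
have sF i : (i < e)%N -> (msize (F i) <= D.+1)%N.
  move=> ie; apply: leq_trans (leqnSn _); apply: leq_trans (leqnSn _).
  exact: (leq_bigmax (Ordinal ie)).
have Wn i : (i <= e)%N -> W i !=set0.
  elim: i => // i IH ie; have [y Wy] := IH (ltnW ie).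
  by exists y; exact: (WS i ie).
have ind i N : (i <= e)%N -> indep_family (W i) (N * D) 'C(N + i, i).
  elim: i N => [|i IH] N ie.
    by rewrite bin0; apply: indep_family1.
  (* Pascal's rule matches [indep_family_step]: one binomial comes from [W i] in degree [N.+1 * D],
     the other from [W i.+1] in degree [N * D]. *)
  elim: N => [|N IHN].
    by rewrite add0n binn; apply: indep_family1; exact: Wn.
  rewrite addSn binS mulSn addnC [(N + i.+1)%N]addnS.
  have [Fv Freg] := hF i ie.
  rewrite [(N * D + D)%N]addnC [(D + N * D)%N]addnC.
  apply: (indep_family_step (WS i ie) (sF i ie) Fv Freg).
  - by have := IH N.+1 (ltnW ie); rewrite mulSn addnC addSn.
  - by move: IHN; rewrite addnS.
(* With this [c], (d+1)! (cD+1)^d <= c (c+1)^d < (c+1)^(d+1), and the last term is at most the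
   falling factorial (d+1)! 'C(c+d+1, d+1). *)
pose c := (d.+1`! * D ^ d)%N.
have := indep_family_le (ind d.+1 c lt_de).
apply/negP; rewrite -ltnNge.
rewrite -(ltn_pmul2r (fact_gt0 d.+1)) bin_ffact.
apply: leq_trans (expn_le_ffact c d.+1); rewrite expnS.
apply: (@leq_ltn_trans (c * c.+1 ^ d)%N); last by rewrite ltn_mul2r expn_gt0/= ltnSn.
rewrite {2}/c [X in (X <= _)%N]mulnC -mulnA leq_mul2l -expnMn; apply/orP; right.
case: (d) => [|d']; first by rewrite !expn0.
by rewrite leq_exp2r// mulnS [(D * c)%N]mulnC addnC -addn1 leq_add2l.
Qed.

End ChainBound.

(** * Affine charts *)

Section PolynomialZeros.
Variable K : closedFieldType.

Lemma poly_forall0 (P : {poly K}) : (forall s, P.[s] = 0) -> P = 0.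
Proof.
move=> h; apply/eqP; apply: contraT => /closed_nonrootP[s].
by rewrite /root h eqxx.
Qed.

(** Irreducibility of affine space: on the line through [y1] and [y2] both functions become nonzero
    univariate polynomials, and their product has a non-root. *)
Lemma polyfun_common_nonzero d (f1 f2 : 'rV[K]_d -> K) y1 y2 :
  polyfun f1 -> polyfun f2 -> f1 y1 != 0 -> f2 y2 != 0 ->
  exists s, f1 (y1 + s *: (y2 - y1)) != 0 /\ f2 (y1 + s *: (y2 - y1)) != 0.
Proof.
move=> pf1 pf2 f1y f2y.
have [P1 h1] := polyfun_line y1 (y2 - y1) pf1.
have [P2 h2] := polyfun_line y1 (y2 - y1) pf2.
have P1n : P1 != 0.
  by apply: contraNneq f1y => P0; rewrite -[y1]addr0 -(scale0r (y2 - y1)) h1 P0 horner0.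
have P2n : P2 != 0.
  apply: contraNneq f2y => P0; have := h2 1.
  by rewrite scale1r addrC subrK P0 horner0 => ->.
have /closed_nonrootP[s] : P1 * P2 != 0 by rewrite mulf_neq0.
by rewrite rootM negb_or /root -h1 -h2 => /andP[]; exists s.
Qed.

End PolynomialZeros.

(** * Irreducibility of closures of images *)

Section IrreducibleImages.
Variables (K : closedFieldType) (d : nat) (T : topologicalType).
Variables (L : set 'rV[K]_d) (g : 'rV[K]_d -> K) (psi : 'rV[K]_d -> T).
Hypothesis (Lline : forall y1 y2 s, L y1 -> L y2 -> L (y1 + s *: (y2 - y1))).
Hypothesis (pg : polyfun g).
Let S := [set y | L y /\ g y != 0].
Hypothesis (psi_cont : forall y (A : set T), S y -> nbhs (psi y) A ->
  exists h, [/\ polyfun h, h y != 0 & forall y', S y' -> h y' != 0 -> A (psi y')]).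

(** If neither closed set contains the image, each complement pulls back to a nonempty principal
    open part of [S]. Two such parts meet on a line inside [L]. Here [L] will be a coordinate
    subspace, for chains, or the whole space, for connectedness. *)
Lemma irreducible_closure_image : S !=set0 -> irreducible_set (closure (psi @` S)).
Proof.
move=> [y0 Sy0]; split; first by exists (psi y0); apply: subset_closure; exists y0.
move=> A B cA cB hAB; apply: contrapT => /not_orP[nA nB].
have key C : closed C -> ~ closure (psi @` S) `<=` C -> exists h y,
    [/\ polyfun h, h y != 0, S y & forall y', S y' -> h y' != 0 -> ~ C (psi y')].
  move=> cC nC; have /existsNP[y /not_implyP[Sy ny]] : ~ forall y, S y -> C (psi y).
    apply: contra_not nC => h; rewrite (proj1 (closure_id _) cC).
    by apply: closure_subset => _ [y Sy <-]; exact: h.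
  have [h [ph hy hC]] : exists h, [/\ polyfun h, h y != 0 &
      forall y', S y' -> h y' != 0 -> (~` C) (psi y')].
    by apply: psi_cont => //; apply: open_nbhs_nbhs; split=> //; exact: closed_openC.
  by exists h, y.
have [h1 [y1 [ph1 hy1 Sy1 hA]]] := key A cA nA.
have [h2 [y2 [ph2 hy2 Sy2 hB]]] := key B cB nB.
(* The factor [g] keeps the common point inside [S]. *)
have [s [s1 s2]] : exists s,
  h1 (y1 + s *: (y2 - y1)) * g (y1 + s *: (y2 - y1)) != 0 /\
  h2 (y1 + s *: (y2 - y1)) * g (y1 + s *: (y2 - y1)) != 0.
  apply: (@polyfun_common_nonzero _ _ (fun y => h1 y * g y) (fun y => h2 y * g y)).
  - exact: polyfunM.
  - exact: polyfunM.
  - by rewrite mulf_neq0//; case: Sy1.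
  - by rewrite mulf_neq0//; case: Sy2.
move: s1 s2; rewrite !mulf_eq0 !negb_or => /andP[a1 ag] /andP[a2 _].
set y := y1 + _ in a1 a2 ag.
have Sy : S y by split=> //; apply: Lline; [case: Sy1|case: Sy2].
case: (hAB (psi y)); [by apply: subset_closure; exists y|exact: hA|exact: hB].
Qed.

End IrreducibleImages.

Lemma irreducible_connected (T : topologicalType) (Z : set T) :
  irreducible_set Z -> connected Z.
Proof.
move=> [_ irr] B [b Bb] [C oC EC] [D cD ED].
have [] := irr (~` C) D; [exact: open_closedC|exact: cD| | |].
- move=> z Zz; have [Cz|] := pselect (C z); last by left.
  right; have : B z by rewrite EC.
  by rewrite ED => -[].
- by move=> /(_ b) h; move: Bb; rewrite EC => -[/h].
- by move=> h; rewrite ED; apply/seteqP; split=> [z []//|z Zz]; split=> //; exact: h.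
Qed.

(** * Local dimension and cotangent space in a chart *)

Section Charts.
Variables (K : closedFieldType) (d : nat) (X : funspace K).

(** An isomorphism of the principal open set of [g] in A^d onto an open subset of [X]. The map [psi]
    is total, but only its values where [g] is nonzero are constrained. *)
Record affine_chart (g : 'rV[K]_d -> K) (psi : 'rV[K]_d -> X) : Prop := AffineChart {
  chart_poly : polyfun g;
  chart_inj : forall y y', g y != 0 -> g y' != 0 -> psi y = psi y' -> y = y';
  chart_cont : forall y (A : set X), g y != 0 -> nbhs (psi y) A ->
    exists h, [/\ polyfun h, h y != 0 &
      forall y', g y' != 0 -> h y' != 0 -> A (psi y')];
  chart_open : forall h, polyfun h ->
    open [set psi y | y in [set y | g y != 0 /\ h y != 0]];
  chart_regular : forall y f, g y != 0 ->
    regular_at (psi y) f <-> exists F G, [/\ polyfun F, polyfun G, G y != 0 &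
      forall y', g y' != 0 -> G y' != 0 -> f (psi y') = F y' / G y'] }.

Variables (g : 'rV[K]_d -> K) (psi : 'rV[K]_d -> X).
Hypothesis ch : affine_chart g psi.
Variables (y0 : 'rV[K]_d).
Hypothesis gy0 : g y0 != 0.

(** The chain is pulled back to the chart, where irreducibility becomes primality of the vanishing
    ideal and [prime_chain_le] applies. *)
Lemma chart_local_dim_le e Z :
  irreducible_chain [set Z : set X | Z (psi y0)] e Z -> (e <= d)%N.
Proof.
move=> [hZ hlt].
pose W i := [set y | g y != 0 /\ Z i (psi y)].
apply: (@prime_chain_le _ _ _ W).
- by exists y0; split=> //; have [] := hZ 0.
- by move=> i ie y [gy Zy]; split=> //; have [sub _] := hlt i ie; exact: sub.
- move=> i ie F H pF pH hFH; have [cZ [_ irr] Zp] := hZ i ie.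
  have clo f : polyfun f ->
      closed (~` [set psi y | y in [set y | g y != 0 /\ f y != 0]]).
    by move=> pf; apply: open_closedC; exact: (chart_open ch).
  have [|h|h] := irr _ _ (clo F pF) (clo H pH).
  + move=> z Zz; apply: contrapT => /not_orP[/contrapT[y [gy Fy] E] /contrapT[y' [gy' Hy] E']].
    have yy' : y = y' by apply: (chart_inj ch) => //; rewrite E E'.
    have /eqP := hFH y (conj gy (eq_ind_r (Z i) Zz E)).
    by rewrite mulf_eq0 (negbTE Fy) yy' (negbTE Hy).
  + left=> y [gy Zy]; apply/eqP; apply: contraT => Fy.
    by case: (h _ Zy); exists y.
  + by right=> y [gy Zy]; apply/eqP; apply: contraT => Hy; case: (h _ Zy); exists y.
- move=> i ie; have [cZ _ Zp] := hZ i (ltnW ie).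
  have [cZ' [_ irr] Zp'] := hZ i.+1 ie; have [_ nsub] := hlt i ie.
  pose U := [set psi y | y in [set y | g y != 0 /\ (1 : K) != 0]].
  have oU : open U by apply: (chart_open ch); exact: polyfun_cst.
  (* Strictness survives in the chart: the irreducible set [Z i.+1] meets the open image of the
     chart, so it is not covered by [Z i] and the complement of that image. *)
  have [y [gy Zy nZy]] : exists y, [/\ g y != 0, Z i.+1 (psi y) & ~ Z i (psi y)].
    apply: contrapT => hn; case: (irr (Z i) (~` U) cZ (open_closedC oU)) => //.
      move=> z Zz; have [|] := pselect (U z); last by right.
      case=> y [gy _] E; left; apply: contrapT => nZ; apply: hn.
      by exists y; rewrite E.
    move=> /(_ (psi y0) Zp'); apply; exists y0 => //; split=> //; exact: oner_neq0.
  have [|h [ph hy hA]] := chart_cont ch (A := ~` Z i) gy.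
    by apply: open_nbhs_nbhs; split=> //; exact: closed_openC.
  exists h; split=> // [y' [gy' Zy']|h0].
    by apply/eqP; apply: contraT => hy'; case: (hA y').
  by move: hy; rewrite h0 ?eqxx.
Qed.

(** The chain consists of the closures of the images of the affine subspaces [L i] through [y0] in
    which only the first [i] coordinates move. *)
Lemma chart_local_chain :
  exists Z, irreducible_chain [set Z : set X | Z (psi y0)] d Z.
Proof.
pose L i := [set y : 'rV[K]_d | forall j : 'I_d, (i <= j)%N -> y 0 j = y0 0 j].
pose S i := [set y | L i y /\ g y != 0].
have Sy0 i : S i y0 by [].
exists (fun i => closure (psi @` S i)); split.
  move=> i _; split; first exact: closed_closure.
    apply: (@irreducible_closure_image _ _ _ (L i) g); last by exists y0.
    - move=> y1 y2 s L1 L2 j ij; rewrite !mxE L1// L2// subrr mulr0 addr0//.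
    - exact: chart_poly ch.
    - move=> y A [_ gy] yA; have [h [ph hy hA]] := chart_cont ch gy yA.
      by exists h; split=> // y' [_ gy']; exact: hA.
  by apply: subset_closure; exists y0.
move=> i id; split.
  by apply: closure_subset => _ [y [Ly gy] <-]; exists y => //; split=> // j /ltnW; exact: Ly.
pose io := Ordinal id.
have pc : polyfun (fun y : 'rV[K]_d => y 0 io - y0 0 io).
  by apply: polyfunD; [exact: polyfun_coord|exact: polyfun_cst].
have e0 : (y0 + delta_mx 0 io) 0 io - y0 0 io != 0.
  by rewrite !mxE !eqxx/= addrAC subrr add0r oner_neq0.
have [s []] := polyfun_common_nonzero (chart_poly ch) pc gy0 e0.
have -> : y0 + delta_mx 0 io - y0 = delta_mx 0 io by rewrite addrAC subrr add0r.
move=> gy.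
rewrite !mxE !eqxx/= mulr1 addrAC subrr add0r => s0.
set y := y0 + _ in gy.
move=> sub; have /sub hc : closure (psi @` S i.+1) (psi y).
  apply: subset_closure; exists y => //; split=> // j ij.
  rewrite !mxE eqxx/=; case: eqP ij => [->|_ _]; first by rewrite ltnn.
  by rewrite mulr0 addr0.
(* The open set where coordinate [io] differs from that of [y0] contains [psi y] but misses the
   image of [S i]. *)
have := hc [set psi y | y in [set y | g y != 0 /\ y 0 io - y0 0 io != 0]].
case.
  apply: open_nbhs_nbhs; split; first exact: (chart_open ch).
  by exists y => //; split=> //; rewrite !mxE !eqxx/= mulr1 addrAC subrr add0r.
move=> _ [[y1 [L1 g1] <-] [y2 [g2 n2]] E].
have E12 : y2 = y1 by apply: (chart_inj ch).
by move: n2; rewrite E12 L1// subrr eqxx.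
Qed.

Lemma chart_local_dim : local_dim (psi y0) d.
Proof.
split; [exact: chart_local_chain|by move=> e Z; exact: chart_local_dim_le].
Qed.

Definition chart_inv (q : X) : 'rV[K]_d := xget 0 [set y | g y != 0 /\ psi y = q].

Lemma chart_invK y : g y != 0 -> chart_inv (psi y) = y.
Proof.
move=> gy; have [//|gx E] := @xgetPex _ 0 [set x | g x != 0 /\ psi x = psi y] _.
  by exists y.
exact: (chart_inj ch).
Qed.

(** [phi] is s^e times a rational function regular at 0. Equality is demanded only where [B] is
    nonzero, so a factor common to [A] and [B] discards unwanted values of [s]. *)
Definition vanishing_order (e : nat) (phi : K -> K) : Prop :=
  exists A B : {poly K}, B.[0] != 0 /\
    forall s, B.[s] != 0 -> phi s = s ^+ e * (A.[s] / B.[s]).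

Lemma vanishing_orderD e phi1 phi2 :
  vanishing_order e phi1 -> vanishing_order e phi2 ->
  vanishing_order e (fun s => phi1 s + phi2 s).
Proof.
move=> [A1 [B1 [B10 h1]]] [A2 [B2 [B20 h2]]].
exists (A1 * B2 + A2 * B1), (B1 * B2); split=> [|s]; first by rewrite hornerM mulf_neq0.
rewrite hornerM mulf_eq0 negb_or => /andP[b1 b2]; rewrite /= h1// h2// hornerD !hornerM.
by field; rewrite b1 b2.
Qed.

Lemma vanishing_orderM e1 e2 phi1 phi2 :
  vanishing_order e1 phi1 -> vanishing_order e2 phi2 ->
  vanishing_order (e1 + e2) (fun s => phi1 s * phi2 s).
Proof.
move=> [A1 [B1 [B10 h1]]] [A2 [B2 [B20 h2]]].
exists (A1 * A2), (B1 * B2); split=> [|s]; first by rewrite hornerM mulf_neq0.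
rewrite hornerM mulf_eq0 negb_or => /andP[b1 b2]; rewrite /= h1// h2// !hornerM.
by rewrite mulrACA exprD mulf_div.
Qed.

Lemma vanishing_order_sum e r (phi : 'I_r -> K -> K) :
  (forall j, vanishing_order e (phi j)) ->
  vanishing_order e (fun s => \sum_j phi j s).
Proof.
elim: r phi => [|r IH] phi h.
  exists 0, 1; split=> [|s _]; first by rewrite hornerC oner_neq0.
  by rewrite big_ord0 horner0 mul0r mulr0.
have -> : (fun s => \sum_j phi j s) =
    (fun s => phi ord0 s + \sum_j phi (lift ord0 j) s).
  by apply/funext => s; rewrite big_ord_recl.
by apply: vanishing_orderD => //; exact: IH.
Qed.

Definition chart_line (i : 'I_d) (s : K) : 'rV[K]_d := y0 + s *: delta_mx 0 i.

Lemma max_ideal_vanishing i f : in_max_ideal (psi y0) f ->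
  vanishing_order 1 (fun s => f (psi (chart_line i s))).
Proof.
move=> [/(chart_regular ch _ gy0)[F [G [pF pG G0 hf]]] f0].
have [PF hF] := polyfun_line y0 (delta_mx 0 i) pF.
have [PG hG] := polyfun_line y0 (delta_mx 0 i) pG.
have [Pg hg] := polyfun_line y0 (delta_mx 0 i) (chart_poly ch).
have line0 : y0 + 0 *: delta_mx 0 i = y0 by rewrite scale0r addr0.
have /factor_theorem[Q PFE] : root PF 0.
  rewrite /root -hF line0; move: f0; rewrite hf// => /eqP.
  by rewrite mulf_eq0 invr_eq0 (negbTE G0) orbF.
(* The common factor [Pg] confines the formula to the part of the line inside the chart. *)
exists (Q * Pg), (PG * Pg); split=> [|s].
  by rewrite hornerM -hG -hg line0 mulf_neq0.
rewrite !hornerM mulf_eq0 negb_or => /andP[Gs gs].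
rewrite /chart_line hf ?hF ?hG ?hg// PFE hornerM hornerXsubC.
by field; rewrite gs Gs.
Qed.

Lemma max_ideal_sq_vanishing i f : in_max_ideal_sq (psi y0) f ->
  vanishing_order 2 (fun s => f (psi (chart_line i s))).
Proof.
move=> [r [u [v [uv hn]]]].
have [h [ph h0 hh]] := chart_cont ch gy0 hn.
have [A [B [B0 hAB]]] : vanishing_order 2 (fun s => \sum_(j < r)
    u j (psi (chart_line i s)) * v j (psi (chart_line i s))).
  apply: vanishing_order_sum => j; have [hu hv] := uv j.
  by apply: (@vanishing_orderM 1 1); exact: max_ideal_vanishing.
have [Ph hP] := polyfun_line y0 (delta_mx 0 i) ph.
have [Pg hg] := polyfun_line y0 (delta_mx 0 i) (chart_poly ch).
have line0 : y0 + 0 *: delta_mx 0 i = y0 by rewrite scale0r addr0.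
exists (A * (Ph * Pg)), (B * (Ph * Pg)); split=> [|s].
  by rewrite !hornerM -hP -hg line0 !mulf_neq0.
rewrite !hornerM !mulf_eq0 !negb_or => /and3P[Bs Ps gs].
rewrite hh /chart_line ?hP ?hg// hAB//.
by rewrite -[in RHS]mulf_div divff ?mulf_neq0// mulr1.
Qed.

(** Writing f = F/G, Hadamard's formula for F gives f = sum_i t_i h_i/G; replacing each h_i/G by its
    value at [y0] changes f by an element of the square of the maximal ideal. For uniqueness, the
    difference of two expansions, restricted to the i-th coordinate line, is (b_i - a_i) s and
    vanishes to order 2. *)
Lemma chart_cotangent_basis :
  cotangent_basis (psi y0) (fun i q => chart_inv q 0 i - y0 0 i).
Proof.
split=> [i|f hf].
  split; last by rewrite chart_invK// subrr.
  apply/(chart_regular ch _ gy0).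
  exists (fun y => y 0 i - y0 0 i), (fun=> 1); split.
  - by apply: polyfunD; [exact: polyfun_coord|exact: polyfun_cst].
  - exact: polyfun_cst.
  - exact: oner_neq0.
  - by move=> y gy _; rewrite chart_invK// divr1.
have uniq (a b : 'rV[K]_d) :
    in_max_ideal_sq (psi y0) (fun q => f q - \sum_(i < d) a 0 i * (chart_inv q 0 i - y0 0 i)) ->
    in_max_ideal_sq (psi y0) (fun q => f q - \sum_(i < d) b 0 i * (chart_inv q 0 i - y0 0 i)) ->
    a = b.
  move=> ha hb; apply/rowP => i.
  have [A [B [B0 hA]]] := max_ideal_sq_vanishing i ha.
  have [A' [B' [B'0 hA']]] := max_ideal_sq_vanishing i hb.
  have [Pg hg] := polyfun_line y0 (delta_mx 0 i) (chart_poly ch).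
  have line0 : y0 + 0 *: delta_mx 0 i = y0 by rewrite scale0r addr0.
  have Pg0 : Pg.[0] != 0 by rewrite -hg line0.
  (* [Q] is what remains after clearing denominators and dividing by s. It vanishes away from the
     roots of 'X, [B], [B'] and [Pg], hence identically, and its value at 0 yields a_i = b_i. *)
  pose Q := (b 0 i - a 0 i) *: (B * B') - 'X * (A * B' - A' * B).
  suff Q0 : Q = 0.
    have /= := congr1 (horner^~ 0) Q0.
    rewrite !(hornerD, hornerN, hornerZ, hornerM, hornerX, horner0) => /eqP.
    by rewrite mul0r subr0 !mulf_eq0 (negbTE B0) (negbTE B'0) !orbF subr_eq0 => /eqP->.
  have Pn (P : {poly K}) : P.[0] != 0 -> P != 0.
    by apply: contraNneq => ->; rewrite horner0.
  suff : 'X * (B * B' * Pg) * Q == 0.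
    by rewrite !mulf_eq0 polyX_eq0 (negbTE (Pn B B0)) (negbTE (Pn B' B'0))
      (negbTE (Pn Pg Pg0)) /= => /eqP.
  apply/eqP/poly_forall0 => s; rewrite hornerM.
  have [->|s0] := eqVneq s 0; first by rewrite !hornerM hornerX !mul0r.
  have [Bs|Bs] := eqVneq B.[s] 0; first by rewrite !hornerM Bs !(mul0r, mulr0).
  have [B's|B's] := eqVneq B'.[s] 0; first by rewrite !hornerM B's !(mul0r, mulr0).
  have [gs|gs] := eqVneq Pg.[s] 0; first by rewrite !hornerM gs !(mul0r, mulr0).
  have sumE (c : 'rV[K]_d) : \sum_(l < d) c 0 l *
      (chart_inv (psi (chart_line i s)) 0 l - y0 0 l) = c 0 i * s.
    rewrite chart_invK ?hg// (bigD1 i)//= big1 ?addr0 => [|l li].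
      by rewrite !mxE !eqxx mulr1 addrAC subrr add0r.
    by rewrite !mxE (negbTE li) andbF mulr0 addr0 subrr mulr0.
  have E1 := hA s Bs; have E2 := hA' s B's; rewrite /= (sumE a) in E1; rewrite /= (sumE b) in E2.
  suff -> : Q.[s] = 0 by rewrite mulr0.
  rewrite /Q !(hornerD, hornerN, hornerZ, hornerM, hornerX); apply: (mulfI s0); rewrite mulr0.
  have : (b 0 i - a 0 i) * s = s ^+ 2 * (A.[s] / B.[s]) - s ^+ 2 * (A'.[s] / B'.[s]).
    by rewrite -E1 -E2; ring.
  move=> E; have -> : s * ((b 0 i - a 0 i) * (B.[s] * B'.[s]) -
      s * (A.[s] * B'.[s] - A'.[s] * B.[s])) =
    ((b 0 i - a 0 i) * s - (s ^+ 2 * (A.[s] / B.[s]) - s ^+ 2 * (A'.[s] / B'.[s])))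
      * (B.[s] * B'.[s]) by field; rewrite Bs B's.
  by rewrite E subrr mul0r.
have [/(chart_regular ch _ gy0)[F [G [pF pG G0 hFG]]] f0] := hf.
have F0 : F y0 = 0.
  by move: f0; rewrite hFG// => /eqP; rewrite mulf_eq0 invr_eq0 (negbTE G0) orbF => /eqP.
have [h ph hF] := polyfun_taylor y0 pF.
suff hsq : in_max_ideal_sq (psi y0) (fun q => f q -
    \sum_(i < d) (\row_i (h i y0 / G y0)) 0 i * (chart_inv q 0 i - y0 0 i)).
  by exists (\row_i (h i y0 / G y0)); split=> // b; exact: uniq.
exists d, (fun i q => chart_inv q 0 i - y0 0 i),
  (fun i q => h i (chart_inv q) / G (chart_inv q) - h i y0 / G y0); split.
  move=> i; split; split.
  - apply/(chart_regular ch _ gy0).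
    exists (fun y => y 0 i - y0 0 i), (fun=> 1); split.
    + by apply: polyfunD; [exact: polyfun_coord|exact: polyfun_cst].
    + exact: polyfun_cst.
    + exact: oner_neq0.
    + by move=> y gy _; rewrite chart_invK// divr1.
  - by rewrite chart_invK// subrr.
  - apply/(chart_regular ch _ gy0).
    exists (fun y => h i y + - (h i y0 / G y0) * G y), G; split=> //.
      by apply: polyfunD => //; apply: polyfunM => //; exact: polyfun_cst.
    by move=> y gy Gy; rewrite chart_invK// mulrDl mulfK// mulNr.
  - by rewrite chart_invK// subrr.
have : nbhs (psi y0) [set psi y | y in [set y | g y != 0 /\ G y != 0]].
  by apply: open_nbhs_nbhs; split; [exact: (chart_open ch)|exists y0].
apply: filterS => _ [y [gy Gy] <-].
rewrite hFG// hF F0 add0r chart_invK// mulr_suml -sumrB.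
by apply: eq_bigr => i _; rewrite mxE mulrBr; ring.
Qed.

Lemma chart_smooth_at : smooth_at (psi y0).
Proof.
exists d; split; first exact: chart_local_dim.
by exists (fun i q => chart_inv q 0 i - y0 0 i); exact: chart_cotangent_basis.
Qed.

End Charts.

(** All members of a chain contain any point of its smallest member, so every chain is a chain
    through some point. *)
Lemma krull_dim_local (T : topologicalType) (p : T) d :
  (forall q : T, local_dim q d) -> krull_dim T d.
Proof.
move=> h; split.
  have [[Z [hZ hlt]] _] := h p; exists Z; split=> // i id.
  by have [c irr _] := hZ i id.
move=> e Z [hZ hlt].
have [_ [[q Zq] _] _] := hZ 0 (leq0n e).
have [_ bound] := h q; apply: (bound e Z); split=> // i ie.
have [c irr _] := hZ i ie; split=> //.
elim: i ie {c irr} => // i IH ie.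
by have [sub _] := hlt i ie; apply: sub; apply: IH; exact: ltnW.
Qed.

(** * The Segre embedding *)

Section Segre.
Variables (K : closedFieldType) (m k : nat).
Local Notation P := (affproj K 0 ((1 + m) * k)).

(** The Segre product of (1 : x) and v, with A^m viewed as a standard chart of P^m. *)
Definition segre (x : 'rV[K]_m) (v : 'rV[K]_k) : 'rV[K]_((1 + m) * k) :=
  mxvec ((row_mx 1%:M x)^T *m v).

Lemma segreE x v i j : segre x v 0 (mxvec_index i j) = row_mx 1%:M x 0 i * v 0 j.
Proof. by rewrite mxvecE mxE big_ord1 mxE. Qed.

Lemma segre0 x v j : segre x v 0 (mxvec_index (lshift m ord0) j) = v 0 j.
Proof. by rewrite segreE row_mxEl mxE mul1r. Qed.

Lemma segreS x v i j : segre x v 0 (mxvec_index (rshift 1 i) j) = x 0 i * v 0 j.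
Proof. by rewrite segreE row_mxEr. Qed.

Lemma segreZ x v c : segre x (c *: v) = c *: segre x v.
Proof. by rewrite /segre -scalemxAr linearZ. Qed.

Lemma segre_neq0 x v : v != 0 -> segre x v != 0.
Proof.
apply: contraNneq => E; apply/eqP/rowP => j.
by rewrite -(segre0 x v) E !mxE.
Qed.

Lemma segre_inj x v x' v' : v != 0 -> segre x v = segre x' v' -> x = x' /\ v = v'.
Proof.
move=> v0 E; have vv : v = v' by apply/rowP => j; rewrite -(segre0 x v) E segre0.
split=> //; have [j vj] := rV0Pn _ v0.
apply/rowP => i; apply: (mulIf vj).
by rewrite -segreS E segreS vv.
Qed.

Lemma bihomog_segre e (f : 'rV[K]_0 -> 'rV[K]_((1 + m) * k) -> K) :
  bihomog e f -> bihomog e (fun x v => f 0 (segre x v)).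
Proof.
elim=> [c|e1|[]//|l|e1 f1 f2 _ h1 _ h2|e1 e2 f1 f2 _ h1 _ h2].
- exact: bihomog_cst.
- exact: bihomog0.
- case/mxvec_indexP: l => i j.
  apply: (@eq_bihomog _ _ _ _ (fun x v => row_mx 1%:M x 0 i * v 0 j)); last first.
    by move=> x v; rewrite segreE.
  apply: (@bihomogM _ _ _ 0 1); last exact: bihomog_proj.
  case: (split_ordP i) => i' ->.
    by apply: (eq_bihomog (bihomog_cst _ _ (1%:M 0 i'))) => x v; rewrite row_mxEl.
  by apply: (eq_bihomog (bihomog_affine K _ i')) => x v; rewrite row_mxEr.
- exact: bihomogD.
- exact: bihomogM.
Qed.

(* Homogenisation: x_i is replaced by w_(i,j0) / w_(0,j0) and v_j by w_(0,j). *)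
Lemma bihomog_segre_inv e (f : 'rV[K]_m -> 'rV[K]_k -> K) : bihomog e f ->
  exists D0, forall D, (D0 <= D)%N -> forall j0, exists H : 'rV[K]_0 -> _ -> K,
    bihomog (D + e) H /\ forall x v, H 0 (segre x v) = v 0 j0 ^+ D * f x v.
Proof.
pose w0 j0 := mxvec_index (lshift m (ord0 : 'I_1)) j0 : 'I_((1 + m) * k).
have w0X D j0 : bihomog D (fun (_ : 'rV[K]_0) w => w 0 (w0 j0) ^+ D).
  by have := bihomogX D (bihomog_proj K 0 (w0 j0)); rewrite muln1.
elim=> [c|e1|i|j|e1 f1 f2 _ [D1 h1] _ [D2 h2]|e1 e2 f1 f2 _ [D1 h1] _ [D2 h2]].
- exists 0%N => D _ j0; exists (fun _ w => w 0 (w0 j0) ^+ D * c); split.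
    by apply: bihomogM; [exact: w0X|exact: bihomog_cst].
  by move=> x v; rewrite segre0.
- exists 0%N => D _ j0; exists (fun _ _ => 0); split; first exact: bihomog0.
  by move=> x v; rewrite mulr0.
- exists 1%N => -[//|D] _ j0.
  exists (fun _ w => w 0 (mxvec_index (rshift 1 i) j0) * w 0 (w0 j0) ^+ D); split.
    by rewrite addn0; apply: (@bihomogM _ _ _ 1 D); [exact: bihomog_proj|exact: w0X].
  by move=> x v; rewrite segre0 segreS exprSr mulrC [x 0 i * _]mulrC mulrA.
- exists 0%N => D _ j0; exists (fun _ w => w 0 (w0 j0) ^+ D * w 0 (w0 j)); split.
    by apply: bihomogM; [exact: w0X|exact: bihomog_proj].
  by move=> x v; rewrite !segre0.
- exists (maxn D1 D2) => D; rewrite geq_max => /andP[le1 le2] j0.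
  have [H1 [b1 E1]] := h1 D le1 j0; have [H2 [b2 E2]] := h2 D le2 j0.
  exists (fun x w => H1 x w + H2 x w); split; first exact: bihomogD.
  by move=> x v; rewrite E1 E2 mulrDr.
- exists (D1 + D2)%N => D le j0.
  have [H1 [b1 E1]] := h1 D1 (leqnn _) j0.
  have [|H2 [b2 E2]] := h2 (D - D1)%N _ j0.
    by rewrite leq_subRL// (leq_trans _ le)// leq_addr.
  exists (fun x w => H1 x w * H2 x w); split.
    have -> : (D + (e1 + e2) = (D1 + e1) + (D - D1 + e2))%N.
      by rewrite addnACA subnKC// (leq_trans _ le)// leq_addr.
    exact: bihomogM.
  move=> x v; rewrite E1 E2 mulrACA -exprD subnKC//.
  by rewrite (leq_trans _ le)// leq_addr.
Qed.

Definition segre_map (z : affproj K m k) : P :=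
  let v := projT1 (cid (proj_part_ex z)) in
  proj_point 0 (segre_neq0 (affine_part z) (proj_part_neq0 (projT2 (cid (proj_part_ex z))))).

Lemma segre_map_part z w : proj_part (segre_map z) w <->
  exists2 v, proj_part z v & w = segre (affine_part z) v.
Proof.
rewrite /segre_map; case: cid => /= v zv; split.
  move=> [c /= c0 <-]; exists (c *: v); last by rewrite segreZ.
  by rewrite (proj_part_class zv); exists c.
rewrite (proj_part_class zv) => -[_ [c /= c0 <-] ->].
by exists c; rewrite // segreZ.
Qed.

Lemma segre_map_inj : injective segre_map.
Proof.
move=> z z' E; have [v zv] := proj_part_ex z.
have : proj_part (segre_map z) (segre (affine_part z) v).
  by apply/segre_map_part; exists v.
rewrite E => /segre_map_part[v' z'v' /(segre_inj (proj_part_neq0 zv))[xx vv]].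
by apply: (affproj_eq xx zv); rewrite vv.
Qed.

Lemma affine_part0 (z : P) : affine_part z = 0.
Proof. by rewrite thinmx0. Qed.

(** A function defining the neighbourhood is homogenised by [bihomog_segre_inv], with [j0] a
    coordinate that is nonzero at [z]. *)
Lemma segre_map_open z (A : set (affproj K m k)) : nbhs z A ->
  nbhs (segre_map z) [set w | forall z', segre_map z' = w -> A z'].
Proof.
move=> /affproj_nbhsP[e [f [v [bf zv fv hA]]]].
have [D0 /(_ D0 (leqnn _)) hD] := bihomog_segre_inv bf.
have [j0 vj] := rV0Pn _ (proj_part_neq0 zv).
have [H [bH EH]] := hD j0.
apply/affproj_nbhsP; exists (D0 + e)%N, H, (segre (affine_part z) v); split=> //.
- by apply/segre_map_part; exists v.
- by rewrite affine_part0 EH mulf_neq0// expf_neq0.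
move=> w w' ww' Hw' z' E; move: ww'; rewrite -E => /segre_map_part[v' zv' w'E].
move: Hw'; rewrite affine_part0 w'E EH mulf_eq0 negb_or => /andP[_ fv'].
exact: hA zv' fv'.
Qed.

(** Points of the target are matrices up to scalars. The image is given by a nonzero row 0, an open
    condition, and the vanishing of the 2x2 minors involving row 0, a closed one. *)
Lemma segre_image_locally_closed : locally_closed (range segre_map).
Proof.
pose w (i : 'I_(1 + m)) (j : 'I_k) := mxvec_index i j.
pose i0 : 'I_(1 + m) := lshift m ord0.
pose U := \bigcup_j [set z : P | exists2 v, proj_part z v & v 0 (w i0 j) != 0].
pose Q := \bigcup_(a : 'I_(1 + m) * 'I_k * 'I_k)
  [set z : P | exists2 v, proj_part z v &
    v 0 (w a.1.1 a.1.2) * v 0 (w i0 a.2) + (-1) * (v 0 (w a.1.1 a.2) * v 0 (w i0 a.1.2)) != 0].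
have oU : open U.
  by apply: bigcup_open => j _; apply: (@open_nonvanishing _ _ _ 1 (fun _ v => v 0 (w i0 j)));
    exact: bihomog_proj.
have oQ : open Q.
  apply: bigcup_open => a _.
  apply: (@open_nonvanishing _ _ _ 2 (fun _ v =>
    v 0 (w a.1.1 a.1.2) * v 0 (w i0 a.2) + (-1) * (v 0 (w a.1.1 a.2) * v 0 (w i0 a.1.2)))).
  apply: bihomogD; first by apply: (@bihomogM _ _ _ 1 1); exact: bihomog_proj.
  apply: (@bihomogM _ _ _ 0 2); first exact: bihomog_cst.
  by apply: (@bihomogM _ _ _ 1 1); exact: bihomog_proj.
exists U, (~` Q); split=> //; first exact: open_closedC.
apply/seteqP; split=> z.
  move=> [y _ <-]; split.
    have [v yv] := proj_part_ex y; have [j vj] := rV0Pn _ (proj_part_neq0 yv).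
    exists j => //; exists (segre (affine_part y) v); last by rewrite segre0.
    by apply/segre_map_part; exists v.
  move=> [[[i j] j'] _ [_ /segre_map_part[v yv ->]]] /=.
  have e0 : row_mx 1%:M (affine_part y) 0 i0 = 1 by rewrite row_mxEl mxE.
  rewrite !segreE e0 => /negP; apply; apply/eqP; ring.
move=> [[j0 _ [v zv vj0]] nQ].
(* Row 0 is the vector [u], and every other row is a multiple of it; the ratios are read in column
   [j0]. *)
pose x := \row_i (v 0 (w (rshift 1 i) j0) / v 0 (w i0 j0)).
pose u := \row_j v 0 (w i0 j).
have vE : v = segre x u.
  apply/rowP => l; case/mxvec_indexP: l => i j; rewrite segreE.
  have E : v 0 (w i j) * v 0 (w i0 j0) = v 0 (w i j0) * v 0 (w i0 j).
    apply/eqP; rewrite -subr_eq0; apply: contraT => ne; case: nQ.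
    by exists (i, j, j0) => //; exists v => //=; rewrite mulN1r.
  case: (split_ordP i) E => i' -> E.
    by rewrite row_mxEl [i']ord1 !mxE mul1r.
  by rewrite row_mxEr !mxE mulrAC -E mulfK.
have u0 : u != 0.
  by apply: contraNneq vj0 => u0; rewrite vE u0 -(scale0r 0) segreZ scale0r mxE.
exists (proj_point x u0) => //.
apply: (@affproj_eq _ _ _ _ _ v) => //; first by rewrite !affine_part0.
by apply/segre_map_part; exists u; rewrite //=; exact: scaling_class_id.
Qed.

Lemma segre_locally_closed (X : set (affproj K m k)) :
  locally_closed X -> locally_closed (segre_map @` X).
Proof.
case=> U [C [oU cC ->]].
have [V [D [oV cD VD]]] := segre_image_locally_closed.
(* [E A] collects the points all of whose preimages lie in [A]; for open [A] its interior cuts out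
   the image of [A] inside the range. *)
pose E (A : set (affproj K m k)) := [set w | forall z', segre_map z' = w -> A z'].
have mem (A : set (affproj K m k)) z : open A -> A z -> (E A)^° (segre_map z).
  by move=> oA Az; apply: segre_map_open; apply: open_nbhs_nbhs.
exists (V `&` (E U)^°), (D `&` ~` (E (~` C))^°); split.
- by apply: openI => //; exact: open_interior.
- by apply: closedI => //; apply: open_closedC; exact: open_interior.
apply/seteqP; split=> w.
  move=> [z [Uz Cz] <-].
  have [Vz Dz] : (V `&` D) (segre_map z) by rewrite -VD; exists z.
  do 2?split=> //; first exact: mem.
  by move=> /interior_subset /(_ z erefl).
move=> [[Vw Uw] [Dw nCw]]; have [z _ zw] : range segre_map w by rewrite VD.
exists z => //; split; first exact: (interior_subset Uw).
by apply: contrapT => nCz; apply: nCw; rewrite -zw; apply: mem => //; exact: closed_openC.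
Qed.

Lemma segre_isomorphic (X : set (affproj K m k)) :
  isomorphic (subvariety X) (subvariety (segre_map @` X)).
Proof.
set Y := segre_map @` X.
have phiP (p : subvariety X) : segre_map (set_val p) \in Y.
  by apply/mem_set; exists (set_val p) => //; exact: set_valP.
have psiP (q : subvariety Y) : exists p : subvariety X, segre_map (set_val p) = set_val q.
  have [z Xz E] := set_valP q.
  by exists (exist _ z (mem_set Xz)).
pose phi (p : subvariety X) : subvariety Y := exist _ (segre_map (set_val p)) (phiP p).
have [psi psiE] := choice psiP.
have phiK : cancel phi psi.
  move=> p; apply: subvariety_inj; apply: segre_map_inj; exact: psiE.
have psiK : cancel psi phi by move=> q; apply: subvariety_inj; exact: psiE.
exists phi, psi; split=> //; split.
- move=> p A /subvariety_nbhsP[e [f [w [bf pw fw hA]]]].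
  have /segre_map_part[v pv wE] := pw.
  apply/subvariety_nbhsP; exists e, (fun x v => f 0 (segre x v)), v; split=> //.
  + exact: bihomog_segre.
  + by move: fw; rewrite wE affine_part0.
  + move=> q v' qv' fv'; apply: (hA (phi q) (segre (affine_part (set_val q)) v')).
      by apply/segre_map_part; exists v'.
    by rewrite affine_part0.
- move=> p f /regular_atP[e [F [G [w [bF bG pw Gw hf]]]]].
  have /segre_map_part[v pv wE] := pw.
  apply/regular_atP; exists e, (fun x v => F 0 (segre x v)), (fun x v => G 0 (segre x v)), v.
  split=> //; try exact: bihomog_segre.
  + by move: Gw; rewrite wE affine_part0.
  + move=> q v' qv' Gv'; rewrite /=.
    rewrite (hf (phi q) (segre (affine_part (set_val q)) v')) ?affine_part0//.
    by apply/segre_map_part; exists v'.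
- move=> q A /subvariety_nbhsP[e [f [v [bf pv fv hA]]]].
  have [D0 /(_ D0 (leqnn _)) hD] := bihomog_segre_inv bf.
  have [j0 vj] := rV0Pn _ (proj_part_neq0 pv); have [H [bH EH]] := hD j0.
  apply/subvariety_nbhsP; exists (D0 + e)%N, H, (segre (affine_part (set_val (psi q))) v).
  split=> //.
  + by rewrite -psiE; apply/segre_map_part; exists v.
  + by rewrite affine_part0 EH mulf_neq0// expf_neq0.
  + move=> q' w'; rewrite -psiE => /segre_map_part[v' pv' ->].
    rewrite affine_part0 EH mulf_eq0 negb_or => /andP[_ fv'].
    exact: hA pv' fv'.
- move=> q f /regular_atP[e [F [G [v [bF bG pv Gv hf]]]]].
  have [D1 hD1] := bihomog_segre_inv bF; have [D2 hD2] := bihomog_segre_inv bG.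
  have [j0 vj] := rV0Pn _ (proj_part_neq0 pv).
  (* Numerator and denominator are homogenised with the same power of the coordinate [j0], so their
     quotient is unchanged. *)
  have [HF [bHF EF]] := hD1 _ (leq_maxl D1 D2) j0.
  have [HG [bHG EG]] := hD2 _ (leq_maxr D1 D2) j0.
  apply/regular_atP; exists (maxn D1 D2 + e)%N, HF, HG, (segre (affine_part (set_val (psi q))) v).
  split=> //.
  + by rewrite -psiE; apply/segre_map_part; exists v.
  + by rewrite affine_part0 EG mulf_neq0// expf_neq0.
  + move=> q' w'; rewrite -psiE => /segre_map_part[v' pv' ->].
    rewrite affine_part0 EF EG mulf_eq0 negb_or => /andP[vj' Gv'].
    by rewrite /= (hf _ _ pv' Gv') -mulf_div divff// mul1r.
Qed.

End Segre.

Lemma locally_closed_quasi_projective (K : closedFieldType) m k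
    (X : set (affproj K m k.+1)) :
  locally_closed X -> quasi_projective (subvariety X).
Proof.
(* The dimension is chosen so that its successor is convertible to [(1 + m) * k.+1]. *)
move=> lcX; exists (k + m * k.+1)%N, (@segre_map K m k.+1 @` X); split.
  exact: (@segre_locally_closed K m k.+1 X lcX).
exact: (@segre_isomorphic K m k.+1 X).
Qed.

(** * Singular directions *)

Section Cis.
Variable R : realType.
Implicit Types a b : R.

Lemma cisD a b : cis (a + b) = cis a * cis b.
Proof.
rewrite /cis cosD sinD; apply/eqP; rewrite eq_complex/=.
by apply/andP; split; apply/eqP; ring.
Qed.

Lemma cis0 : cis (0 : R) = 1.
Proof. by rewrite /cis cos0 sin0. Qed.

Lemma cisMn a k : cis (a * k%:R) = cis a ^+ k.
Proof.
elim: k => [|k IH]; first by rewrite mulr0 cis0.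
by rewrite -natr1 mulrDr mulr1 cisD IH exprSr.
Qed.

Lemma cis_2pi : cis (2 * pi : R) = 1.
Proof.
rewrite mulr_natl mulr2n cisD /cis cospi sinpi; apply/eqP; rewrite eq_complex/=.
by apply/andP; split; apply/eqP; ring.
Qed.

Lemma cis_2piz (z : int) : cis (2 * pi * z%:~R : R) = 1.
Proof.
case: z => k; first by rewrite -pmulrn cisMn cis_2pi expr1n.
rewrite NegzE mulrNz mulrN.
have : cis (2 * pi * k.+1%:R : R) * cis (- (2 * pi * k.+1%:R)) = 1.
  by rewrite -cisD subrr cis0.
by rewrite cisMn cis_2pi expr1n mul1r.
Qed.

Lemma cis_surj (a b : R) : a ^+ 2 + b ^+ 2 = 1 -> exists t, cis t = (a +i* b)%C.
Proof.
move=> ab1.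
have a1 : -1 <= a <= 1.
  rewrite -ler_norml -(ler_pXn2r (n := 2)) ?nnegrE// expr1n real_normK ?num_real//.
  by rewrite -ab1 lerDl sqr_ge0.
have sa : sin (acos a) = `|b|.
  by rewrite sin_acos// -ab1 addrC addKr sqrtr_sqr.
have ca : cos (acos a) = a by rewrite acosK.
have [b0|b0] := leP 0 b.
  by exists (acos a); rewrite /cis ca sa ger0_norm.
by exists (- acos a); rewrite /cis cosN sinN ca sa ltr0_norm// opprK.
Qed.

Lemma polar_form (z : R[i]) : z != 0 -> exists r t : R, 0 < r /\ z = (r%:C)%C * cis t.
Proof.
case: z => a b; rewrite eq_complex/= negb_and => z0.
have ab0 : 0 < a ^+ 2 + b ^+ 2.
  rewrite lt_neqAle addr_ge0 ?sqr_ge0// andbT eq_sym paddr_eq0 ?sqr_ge0//.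
  by rewrite !sqrf_eq0 negb_and.
pose r := Num.sqrt (a ^+ 2 + b ^+ 2).
have r0 : 0 < r by rewrite sqrtr_gt0.
have rn : r != 0 by rewrite gt_eqF.
have [|t ht] := @cis_surj (a / r) (b / r).
  rewrite !expr_div_n -mulrDl sqr_sqrtr ?ltW// divff// gt_eqF//.
exists r, t; split=> //; rewrite ht; apply/eqP; rewrite eq_complex/= !mul0r subr0 addr0.
by rewrite ![r * _]mulrC !divfK// !eqxx.
Qed.

End Cis.

Section SingularPairs.
Variables (R : realType) (m : nat) (tau : R[i]).
Hypothesis tau0 : tau != 0.
Local Notation n := m.+2.

Lemma zeta_expn : zeta R n ^+ n = 1.
Proof. by rewrite /zeta -cisMn divfK ?cis_2pi// pnatr_eq0. Qed.

Lemma ord_neq_add k (i j : 'I_k) : i != j -> (i + j + 3 <= k + k)%N.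
Proof. by case: i j => [i ik] [j jk]; rewrite -val_eqE /=; lia. Qed.

(* Measure the arguments of the n points zeta^k tau e^(2 pi i d / n) from the  *)
(* direction -i, starting at the index r for which that argument lies in       *)
(* ]-pi/n, pi/n] at d = 0. The difference of the points with indices r + i and *)
(* r + j is a positive multiple of sin (pi (i - j) / n) e^(i sigma) with       *)
(* 0 < sigma < 2 pi, so it is negative only for sigma = pi and j < i.          *)
Lemma singular_dir_start : exists r : 'I_n, forall (d : R) (i j : 'I_n),
  0 <= d < 1 -> singular_dir tau d (r + i, r + j) -> (j < i)%N.
Proof.
have [rho [t [rho0 tauE]]] := polar_form tau0.
have p0 := pi_gt0 R.
have n0 : (0 : R) < n%:R by rewrite ltr0n.
pose h : R := pi / n%:R.
have h0 : 0 < h by rewrite divr_gt0.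
have hn : h * n%:R = pi by rewrite divfK// gt_eqF.
have hE : 2 * pi / n%:R = 2 * h by rewrite mulrA.
(* Then [al] = t + pi/2 + 2hz with z = - ceil u, that is 2h (u - ceil u + 1/2), which lies in ]-h,
   h]. The index [r] is z modulo n. *)
pose u := (t + pi / 2) / (2 * h) - 1 / 2.
pose z := - Num.ceil u.
have [r rz] : exists r : 'I_n, (r : nat) = `|(z %% n%:Z)%Z|%N.
  exists (inZp `|(z %% n%:Z)%Z|%N).
  by rewrite /= modn_small// -ltz_nat gez0_abs ?modz_ge0// ltz_mod.
pose al := 2 * h * (u + 1 / 2 + z%:~R).
have zE : z%:~R = - (Num.ceil u)%:~R :> R by rewrite mulrNz.
have alr : - h < al <= h.
  have /andP[c1 c2] := ceil_itv u; move: c1; rewrite intrB => c1.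
  by rewrite /al zE; apply/andP; split; nra.
have hzeta (i : 'I_n) : zeta R n ^+ (r + i)%R * cis t = cis (- (pi / 2) + al + 2 * h * i%:R).
  have -> : zeta R n ^+ (r + i)%R = zeta R n ^+ (r + i)%N.
    by rewrite [in RHS](divn_eq (r + i) n) exprD mulnC exprM zeta_expn expr1n mul1r.
  rewrite exprD /zeta -!cisMn.
  have rE : (r : nat)%:R = z%:~R - n%:R * ((z %/ n%:Z)%Z)%:~R :> R.
    have hz : z%:~R = ((z %/ n%:Z)%Z)%:~R * n%:R + ((z %% n%:Z)%Z)%:~R :> R.
      by rewrite {1}(divz_eq z n%:Z) rmorphD rmorphM.
    by rewrite rz pmulrn gez0_abs ?modz_ge0// hz; ring.
  have -> : 2 * pi / n%:R * r%:R = 2 * h * z%:~R - 2 * pi * ((z %/ n%:Z)%Z)%:~R.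
    by rewrite hE rE -hn; ring.
  rewrite cisD -[- (2 * pi * _)]mulrN -mulrNz cis_2piz mulr1 -!cisD; congr cis.
  have -> : al = t + pi / 2 + 2 * h * z%:~R.
    by rewrite /al /u subrK mulrDr [X in X + _]mulrC divfK// mulf_neq0// gt_eqF.
  by rewrite hE; ring.
exists r => d i j /andP[d0 d1]; move=> hneg.
(* Half sum and half difference of the two arguments, measured from -i: e^(i(sg + de - pi/2)) -
   e^(i(sg - de - pi/2)) = 2 sin(de) e^(i sg). *)
pose sg := al + h * (i%:R + j%:R + 2 * d).
pose de := h * (i%:R - j%:R).
have {hneg} : sin sg * sin de = 0 /\ cos sg * sin de < 0.
  have {}hneg : (zeta R n ^+ (r + i)%R - zeta R n ^+ (r + j)%R) * tau *
      cis (2 * pi * d / n%:R) < 0 by exact: hneg.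
  move: hneg; rewrite tauE mulrCA -(mulrA (rho%:C)%C) mulrBl.
  have E (l : 'I_n) : zeta R n ^+ (r + l)%R * (cis t * cis (2 * pi * d / n%:R)) =
      cis (- (pi / 2) + al + 2 * h * (l%:R + d)).
    by rewrite mulrA hzeta -cisD; congr cis; rewrite [2 * pi * d / _]mulrAC hE; ring.
  have -> : (zeta R n ^+ (r + i)%R * cis t - zeta R n ^+ (r + j)%R * cis t) *
      cis (2 * pi * d / n%:R) = cis (sg + de - pi / 2) - cis (sg - de - pi / 2).
    rewrite mulrBl -(mulrA (zeta R n ^+ (r + i)%R)) -(mulrA (zeta R n ^+ (r + j)%R)) !E.
    congr (cis _ - cis _); rewrite /sg /de; ring.
  rewrite /cis !cosBpihalf !sinBpihalf (sinB sg de) (cosB sg de) (sinD sg de) (cosD sg de).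
  rewrite ltcE /= !mul0r !subr0 !addr0 => /andP[/eqP e1 e2].
  move: e1; rewrite pmulr_rlt0// in e2 => /esym/eqP.
  rewrite mulf_eq0 gt_eqF//= => /eqP e1; split; lra.
have inn (l : 'I_n) : (l%:R : R) <= n%:R - 1.
  by rewrite lerBrDr natr1 ler_nat.
have i0 : (0 : R) <= i%:R by [].
have j0 : (0 : R) <= j%:R by [].
move=> [sn cn].
have sde : sin de != 0 by apply: contraTneq cn => ->; rewrite mulr0 ltxx.
have ij : i != j.
  by apply: contraNneq sde => ij; rewrite /de ij subrr mulr0 sin0.
(* Distinct indices satisfy 1 <= i + j <= 2n - 3; with -h < al <= h and 0 <= d < 1 this puts [sg]
   strictly between 0 and 2 pi. *)
have ij1 : (1 : R) <= i%:R + j%:R.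
  rewrite -natrD ler1n lt0n addn_eq0; apply: contra ij => /andP[/eqP i00 /eqP j00].
  by apply/eqP/val_inj; rewrite /= i00 j00.
have ij2 : (i%:R + j%:R : R) <= 2 * n%:R - 3.
  have : (i + j + 3 <= n + n)%N by exact: ord_neq_add.
  rewrite -(ler_nat R).
  by rewrite !natrD; lra.
have /andP[al1 al2] := alr.
have sg0 : 0 < sg.
  have : h <= h * (i%:R + j%:R + 2 * d) by rewrite ler_peMr ?(ltW h0)//; lra.
  by rewrite /sg; lra.
have sg2 : sg < 2 * pi.
  have : h * (i%:R + j%:R + 2 * d) < h * (2 * n%:R - 1) by rewrite ltr_pM2l//; lra.
  have -> : h * (2 * n%:R - 1) = 2 * pi - h by rewrite -hn; ring.
  by rewrite /sg; lra.
have sgpi : sg = pi.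
  have s0 : sin sg = 0 by move/eqP: sn; rewrite mulf_eq0 (negbTE sde) orbF => /eqP.
  apply/eqP; rewrite eq_le; apply/andP; split; rewrite leNgt; apply/negP => hlt.
    have : 0 < sin (sg - pi) by apply: sin_gt0_pi; apply/andP; split; lra.
    by rewrite sinB s0 sinpi mul0r mulr0 subrr ltxx.
  by have := @sin_gt0_pi _ sg; rewrite s0 ltxx sg0 hlt => /(_ isT).
have : 0 < sin de by move: cn; rewrite sgpi cospi; lra.
rewrite ltnNge => sp; apply/negP => ijle.
have : 0 <= sin (- de).
  have [->|dn] := eqVneq de 0; first by rewrite oppr0 sin0.
  apply/ltW/sin_gt0_pi; rewrite /de in dn *.
  have ji : (i%:R : R) <= j%:R by rewrite ler_nat.
  apply/andP; split.
    rewrite -mulrN opprB mulr_gt0// lt_neqAle subr_ge0 ji andbT eq_sym.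
    by apply: contraNneq dn => /eqP; rewrite subr_eq0 => /eqP->; rewrite subrr mulr0.
  rewrite -hn -mulrN opprB ltr_pM2l//; have := inn j; lra.
by rewrite sinN; lra.
Qed.

End SingularPairs.

(** * The cyclic vector *)

Section Krylov.
Variables (F : fieldType) (n : nat) (s : {perm 'I_n}).
Implicit Types (U N : 'M[F]_n).

Lemma mulmx_perm_basis U N i j :
  (U *m N) (s i) (s j) = \sum_l U (s i) (s l) * N (s l) (s j).
Proof. by rewrite mxE (reindex_inj (@perm_inj _ s)). Qed.

Definition upper_unitriangular_in U : Prop :=
  forall i j : 'I_n, (j <= i)%N -> U (s i) (s j) = (i == j)%:R.

Lemma upper_unitriangular_in1 : upper_unitriangular_in 1%:M.
Proof. by move=> i j _; rewrite mxE (inj_eq perm_inj). Qed.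

Lemma upper_unitriangular_inM U N : upper_unitriangular_in U ->
  upper_unitriangular_in N -> upper_unitriangular_in (U *m N).
Proof.
move=> hU hN i j ji; rewrite mulmx_perm_basis (bigD1 i)//= hU// eqxx mul1r hN//.
rewrite big1 ?addr0// => l li; have [il|il] := leqP l i.
  by rewrite hU// eq_sym (negbTE li) mul0r.
rewrite hN ?(leq_trans ji (ltnW il))//.
by case: eqP => [lj|_]; rewrite ?mulr0//; move: il; rewrite lj ltnNge ji.
Qed.

End Krylov.

Definition krylov (F : fieldType) n (N : 'M[F]_n.+1) (r : 'I_n.+1) : 'M[F]_n.+1 :=
  \matrix_(i, j) (N ^+ j) i r.

(** In the order [s] the matrix is upper Hessenberg with nonzero subdiagonal, so N^k e_(s 0) has its
    last nonzero coordinate at position k. After a row permutation the Krylov matrix is triangular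
    with nonzero diagonal. *)
Lemma krylov_hessenberg_neq0 (F : fieldType) n (s : {perm 'I_n.+1}) (N : 'M[F]_n.+1) :
  (forall i j : 'I_n.+1, (j.+1 < i)%N -> N (s i) (s j) = 0) ->
  (forall i j : 'I_n.+1, i = j.+1 :> nat -> N (s i) (s j) != 0) ->
  \det (krylov N (s ord0)) != 0.
Proof.
move=> h0 h1.
have key k (i : 'I_n.+1) : (k <= i)%N -> ((N ^+ k) (s i) (s ord0) != 0) = (k == i :> nat).
  elim: k i => [|k IH] i ki.
    rewrite expr0 mxE (inj_eq perm_inj) -val_eqE /= [RHS]eq_sym.
    by case: (_ == _ :> nat); rewrite ?oner_eq0 ?eqxx.
  have kn : (k < n.+1)%N by apply: leq_ltn_trans (ltn_ord i); exact: ltnW.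
  rewrite exprS -mulmxE mulmx_perm_basis (bigD1 (Ordinal kn))//= big1 ?addr0.
    have := IH (Ordinal kn) (leqnn k); rewrite /= eqxx => kk.
    rewrite mulf_eq0 negb_or kk andbT.
    have [E|ne] := eqVneq k.+1 i; first by rewrite h1 /= ?E.
    by rewrite h0 ?eqxx//= ltn_neqAle ne.
  move=> l lk; have [lt|le] := ltnP l k.
    by rewrite h0 ?mul0r//; apply: leq_trans ki.
  have := IH l le; have -> : (k == l :> nat) = false.
    by rewrite eq_sym; apply: negbTE.
  by move/negbFE/eqP->; rewrite mulr0.
set A := krylov _ _.
suff : \det (row_perm s A) != 0.
  by rewrite row_permE det_mulmx mulf_eq0 negb_or => /andP[].
rewrite -det_tr det_trig.
  apply/prodf_neq0 => i _; rewrite !mxE; by rewrite key// eqxx.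
apply/is_trig_mxP => i j ij; rewrite !mxE; apply/eqP/negbNE.
by rewrite key 1?ltnW// eq_sym gtn_eqF.
Qed.

Section MonodromyCyclic.
Variables (R : realType) (m : nat) (tau : R[i]).
Hypothesis tau0 : tau != 0.
Local Notation n := m.+2.

Lemma mem_singular_dirs (d : R) : d \in singular_dirs n tau -> 0 <= d < 1.
Proof.
rewrite /singular_dirs mem_sort.
(* [fset_set] sends an infinite set to the empty one, where membership is absurd. *)
set D := (X in fset_set X); have [fD|nfD] := pselect (finite_set D).
  by rewrite in_fset_set// inE => -[].
by rewrite /fset_set; case: pselect.
Qed.

(** Numbered from [r], every Stokes matrix is upper unitriangular by [singular_dir_start], hence so
    is their product [U]. The formal monodromy shifts the rows of [U] by one up to sign, which gives
    the Hessenberg shape. *)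
Lemma mon_infty_cyclic :
  exists r : 'I_n, forall x, \det (krylov (mon_infty tau x) r) != 0.
Proof.
have [r hr] := singular_dir_start m tau0.
pose s : {perm 'I_n} := perm (addrI r).
exists r => x.
have s0 : s ord0 = r by rewrite permE; apply: addr0.
pose U := \prod_(d <- rev (singular_dirs n tau)) stokes_matrix tau d x.
have Utri : upper_unitriangular_in s U.
  rewrite /U; have : {subset rev (singular_dirs n tau) <= [pred d : R | 0 <= d < 1]}.
    by move=> d; rewrite mem_rev inE; exact: mem_singular_dirs.
  elim: (rev _) => [|d l IH] hl.
    by rewrite big_nil; exact: upper_unitriangular_in1.
  rewrite big_cons -mulmxE; apply: upper_unitriangular_inM; last first.
    by apply: IH => e el; apply: hl; rewrite inE el orbT.
  have d01 : 0 <= d < 1 by apply: (hl d); rewrite mem_head.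
  move=> i j ji; rewrite /stokes_matrix !mxE (inj_eq perm_inj) summxE big1 ?addr0//.
  move=> [k l'] /asboolP /= hd; rewrite !mxE.
  case: eqP => [sil|]; last by rewrite mulr0.
  case: eqP => [sjk|]; last by rewrite andbF mulr0.
  by move: hd; rewrite -sil -sjk !permE => /(hr d _ _ d01); rewrite ltnNge ji.
pose c (j : 'I_n) : R[i] := if (j.+1 < n)%N then 1 else (-1) ^+ n.-1.
have c0 j : c j != 0 by rewrite /c; case: ifP; rewrite ?oner_neq0 ?signr_eq0.
have gE i j : formal_monodromy R n i j = (i == j + 1)%:R * c j.
  have val1 : nat_of_ord (j + 1)%R = (j.+1 %% n)%N.
    by rewrite /= [(1 %% _)%N]modn_small// addn1.
  have E : (i == j + 1) = (i == (j.+1 %% n)%N :> nat) by rewrite -val1.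
  rewrite mxE /c E; case: ifP => jn.
    by rewrite modn_small// mulr1.
  have -> : j.+1 = n by apply/eqP; rewrite eqn_leq ltn_ord leqNgt jn.
  by rewrite modnn mulrC.
have NE (i j : 'I_n) : mon_infty tau x (s i) (s j) = c (s i - 1) * U (s (i - 1)) (s j).
  rewrite /mon_infty -/U mxE (bigD1 (s i - 1))//= gE subrK eqxx mul1r big1 ?addr0.
    by have -> : s (i - 1) = s i - 1 by rewrite !permE addrA.
  move=> l ls; rewrite gE; case: eqP => [E|]; last by rewrite !mul0r.
  by move: ls; rewrite E addrK eqxx.
have pred_val (i : 'I_n) : (0 < i)%N -> nat_of_ord (i - 1)%R = i.-1.
  move=> i0; have : (i.-1 < n)%N by apply: leq_ltn_trans (leq_pred _) (ltn_ord i).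
  move=> h; have -> : i - 1 = Ordinal h; last by [].
  apply/eqP; rewrite subr_eq; apply/eqP/val_inj => /=.
  by rewrite [(1 %% _)%N]modn_small// addn1 prednK// modn_small.
(* Both conditions concern rows of positive index, where [i - 1] does not wrap around. *)
rewrite -s0; apply: krylov_hessenberg_neq0 => i j ij.
  have i0 : (0 < i)%N by apply: leq_trans ij.
  have ji : (j < i.-1)%N by rewrite -ltnS prednK.
  have h : (j <= nat_of_ord (i - 1)%R)%N by rewrite pred_val// ltnW.
  rewrite NE (Utri _ _ h); case: eqP => [E|]; last by rewrite mulr0.
  by move: ji; rewrite -E pred_val// ltnn.
have i1 : i - 1 = j by apply/ord_inj; rewrite pred_val ij.
by rewrite NE i1 Utri// eqxx mulr1.
Qed.

End MonodromyCyclic.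

(** * Commutants of cyclic matrices *)

Section CommutantSpace.
Variables (K : closedFieldType) (p q : nat).
Local Notation n := q.+1.
Variables (N : 'rV[K]_p -> 'M[K]_n) (r : 'I_n).
Hypothesis polyN : forall i j, polyfun (fun x => N x i j).
Hypothesis cycN : forall x, \det (krylov (N x) r) != 0.

Definition commutant_set : set (affproj K p (n * n)) :=
  [set z | exists M : 'M[K]_n,
    [/\ M \in unitmx, proj_part z = scaling_class (mxvec M) &
        M *m N (affine_part z) = N (affine_part z) *m M]].

Local Notation X := (subvariety commutant_set).

Definition krylov_comb x (a : 'rV[K]_n) : 'M[K]_n := \sum_i a 0 i *: N x ^+ i.

(* The coordinates of a commuting matrix on the powers of [N x], scaled by the   *)
(* Krylov determinant: the adjugate keeps them polynomial.                       *)
Definition krylov_coord (x : 'rV[K]_p) (v : 'rV[K]_(n * n)) : 'rV[K]_n :=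
  (\adj (krylov (N x) r) *m col r (vec_mx v))^T.

Lemma krylov_combZ x c a : krylov_comb x (c *: a) = c *: krylov_comb x a.
Proof. by rewrite scaler_sumr; apply: eq_bigr => i _; rewrite mxE scalerA. Qed.

Lemma col_krylov_comb x a : col r (krylov_comb x a) = krylov (N x) r *m a^T.
Proof.
apply/colP => l; rewrite !mxE summxE; apply: eq_bigr => i _.
by rewrite !mxE mulrC.
Qed.

Lemma krylov_combK x a :
  krylov_coord x (mxvec (krylov_comb x a)) = \det (krylov (N x) r) *: a.
Proof.
by rewrite /krylov_coord mxvecK col_krylov_comb mulmxA mul_adj_mx mul_scalar_mx linearZ/= trmxK.
Qed.

Lemma krylov_comb_comm x a : krylov_comb x a *m N x = N x *m krylov_comb x a.
Proof.
rewrite mulmx_suml mulmx_sumr; apply: eq_bigr => i _.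
by rewrite -scalemxAl -scalemxAr mulmxE -exprSr -exprS.
Qed.

(* A matrix commuting with N and killing the cyclic vector e_r is zero. *)
Lemma commutant_krylov_comb x (M : 'M[K]_n) :
  M *m N x = N x *m M -> exists a, M = krylov_comb x a.
Proof.
move=> MN; have kU : krylov (N x) r \in unitmx by rewrite unitmxE unitfE.
(* The coefficients are forced: M e_r must be their combination of the Krylov vectors. *)
pose a := (invmx (krylov (N x) r) *m col r M)^T.
exists a; apply/eqP; rewrite -subr_eq0.
have [D DE] : exists D, D = M - krylov_comb x a by exists (M - krylov_comb x a).
rewrite -DE.
have DN i : D *m N x ^+ i = N x ^+ i *m D.
  rewrite !mulmxE; apply: commrX; rewrite /GRing.comm -!mulmxE.
  by rewrite DE mulmxBl mulmxBr MN krylov_comb_comm.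
have Dr l : D l r = 0.
  have : col r D = 0.
    by rewrite DE linearB/= col_krylov_comb trmxK mulmxA mulmxV// mul1mx; exact: subrr.
  by move/colP/(_ l); rewrite !mxE.
(* [D] commutes with the powers of [N x] and kills e_r, hence kills every Krylov vector. *)
suff Dk : D *m krylov (N x) r = 0 by rewrite -[D](mulmxK kU) Dk mul0mx.
apply/matrixP => i j; have := congr1 (fun A : 'M_n => A i r) (DN j).
rewrite /= !mxE; under [in RHS]eq_bigr do rewrite Dr mulr0.
rewrite big1_eq => E; rewrite -[RHS]E; apply: eq_bigr => l _.
by rewrite [in LHS]mxE.
Qed.

Lemma polyfun_krylov_pow i l j : polyfun (fun x => (N x ^+ i) l j).
Proof.
elim: i l j => [|i IH] l j.
  by apply: (eq_polyfun (polyfun_cst _ ((1%:M : 'M[K]_n) l j))).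
have h := polyfun_mulmx polyN IH.
by apply: (eq_polyfun (h l j)) => x; rewrite exprS mulmxE.
Qed.

Lemma bihomog_krylov_coord i : bihomog 1 (fun x v => krylov_coord x v 0 i).
Proof.
apply: (@eq_bihomog _ _ _ _ (fun x v =>
  \sum_l \adj (krylov (N x) r) i l * v 0 (mxvec_index l r))); last first.
  by move=> x v; rewrite mxE mxE; apply: eq_bigr => l _; rewrite [col _ _ _ _]mxE [vec_mx _ _ _]mxE.
apply: bihomog_sum => l _; apply: (@bihomogM _ _ _ 0 1); last exact: bihomog_proj.
apply: bihomog_polyfun.
apply: (@eq_polyfun _ _ (fun x => cofactor (krylov (N x) r) l i)); last first.
  by move=> x; rewrite mxE.
apply: polyfunM; first exact: polyfun_cst.
apply: polyfun_det => i1 i2.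
apply: (eq_polyfun (polyfun_krylov_pow (lift i i2) (lift l i1) r)) => x.
by rewrite !mxE.
Qed.

Lemma krylov_coordZ x c v : krylov_coord x (c *: v) = c *: krylov_coord x v.
Proof.
apply/rowP => i; have /= E := bihomogZ c x v (bihomog_krylov_coord i).
by rewrite E expr1 [RHS]mxE.
Qed.

Lemma polyfun_krylov_comb d (A : 'rV[K]_d -> 'rV[K]_p) (B : 'rV[K]_d -> 'rV[K]_n) :
  (forall i, polyfun (fun y => A y 0 i)) -> (forall i, polyfun (fun y => B y 0 i)) ->
  forall i j, polyfun (fun y => krylov_comb (A y) (B y) i j).
Proof.
move=> hA hB i j.
apply: (@eq_polyfun _ _ (fun y => \sum_l B y 0 l * (N (A y) ^+ l) i j)); last first.
  by move=> y; rewrite summxE; apply: eq_bigr => l _; rewrite mxE.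
apply: polyfun_sum => l _; apply: polyfunM => //.
exact: (polyfun_comp hA (polyfun_krylov_pow l i j)).
Qed.

Lemma unitmx_mxvec_neq0 (M : 'M[K]_n) : M \in unitmx -> mxvec M != 0.
Proof.
apply: contraTneq => /(congr1 vec_mx); rewrite mxvecK linear0 => ->.
by rewrite unitmxE det0 unitr0.
Qed.

Lemma commutant_rep (z : X) v : proj_part (set_val z) v ->
  exists a, [/\ krylov_comb (affine_part (set_val z)) a \in unitmx &
    v = mxvec (krylov_comb (affine_part (set_val z)) a)].
Proof.
have [M [MU zM /commutant_krylov_comb[a Ma]]] := set_valP z.
rewrite zM => -[c /= c0 <-]; exists (c *: a).
by rewrite krylov_combZ -Ma unitmxZ ?unitfE// linearZ.
Qed.

Lemma krylov_comb_point x a : krylov_comb x a \in unitmx ->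
  exists z : X, affine_part (set_val z) = x /\
    proj_part (set_val z) (mxvec (krylov_comb x a)).
Proof.
move=> u; have hz : proj_point x (unitmx_mxvec_neq0 u) \in commutant_set.
  apply/mem_set; exists (krylov_comb x a); split=> //.
  exact: krylov_comb_comm.
by exists (exist (fun z => z \in commutant_set) _ hz); split=> //; exact: scaling_class_id.
Qed.

(** Makes the parametrisation total: where the combination is singular any point is allowed, and the
    identity matrix, with coefficients [delta_mx 0 0], supplies one. *)
Lemma commutant_point_ex (xa : 'rV[K]_p * 'rV[K]_n) : exists z : X,
  krylov_comb xa.1 xa.2 \in unitmx -> affine_part (set_val z) = xa.1 /\
    proj_part (set_val z) (mxvec (krylov_comb xa.1 xa.2)).
Proof.
case: xa => x a /=; have [u|nu] := boolP (krylov_comb x a \in unitmx).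
  by have [z hz] := krylov_comb_point u; exists z.
have [|z _] := @krylov_comb_point 0 (delta_mx 0 0); last by exists z.
rewrite /krylov_comb (bigD1 0)//= big1 ?addr0 => [|i i0].
  by rewrite mxE !eqxx scale1r expr0 unitmx1.
by rewrite mxE (negbTE i0) andbF scale0r.
Qed.

Definition commutant_point x a : X := projT1 (cid (commutant_point_ex (x, a))).

Lemma affine_commutant_point x a : krylov_comb x a \in unitmx ->
  affine_part (set_val (commutant_point x a)) = x.
Proof. by rewrite /commutant_point; case: cid => z /= h /h[]. Qed.

Lemma proj_commutant_point x a : krylov_comb x a \in unitmx ->
  proj_part (set_val (commutant_point x a)) (mxvec (krylov_comb x a)).
Proof. by rewrite /commutant_point; case: cid => z /= h /h[]. Qed.

Lemma commutant_point_eq (z : X) x a : krylov_comb x a \in unitmx ->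
  affine_part (set_val z) = x -> proj_part (set_val z) (mxvec (krylov_comb x a)) ->
  z = commutant_point x a.
Proof.
move=> u zx zv; apply: subvariety_inj; apply: (affproj_eq _ zv).
  by rewrite affine_commutant_point.
exact: proj_commutant_point.
Qed.

Lemma commutant_point_surj (z : X) : exists x a,
  krylov_comb x a \in unitmx /\ z = commutant_point x a.
Proof.
have [v zv] := proj_part_ex (set_val z); have [a [u E]] := commutant_rep zv.
exists (affine_part (set_val z)), a; split=> //.
by apply: commutant_point_eq => //; rewrite -E.
Qed.

(** Stated for arbitrary polynomial [A] and [B] so as to serve both the charts, where a coordinate
    of [a] is fixed to 1, and the space of all pairs (x, a). *)
Lemma commutant_point_cont d (A : 'rV[K]_d -> 'rV[K]_p) (B : 'rV[K]_d -> 'rV[K]_n) :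
  (forall i, polyfun (fun y => A y 0 i)) -> (forall i, polyfun (fun y => B y 0 i)) ->
  forall y (U : set X), \det (krylov_comb (A y) (B y)) != 0 ->
  nbhs (commutant_point (A y) (B y)) U ->
  exists h, [/\ polyfun h, h y != 0 & forall y', \det (krylov_comb (A y') (B y')) != 0 ->
    h y' != 0 -> U (commutant_point (A y') (B y'))].
Proof.
move=> hA hB y U; rewrite -unitfE -unitmxE => uy.
move=> /subvariety_nbhsP[e [f [v [bf zv fv hU]]]].
exists (fun y => f (A y) (mxvec (krylov_comb (A y) (B y)))); split.
- apply: (polyfun_bihomog hA _ bf) => i; case/mxvec_indexP: i => i j.
  by apply: (eq_polyfun (polyfun_krylov_comb hA hB i j)) => y'; rewrite mxvecE.
- have := bihomog_rep bf zv (proj_commutant_point uy) fv.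
  by rewrite affine_commutant_point.
- move=> y'; rewrite -unitfE -unitmxE => uy' fy'.
  apply: (hU _ _ (proj_commutant_point uy')).
  by rewrite affine_commutant_point.
Qed.

Section Chart.
Variable j : 'I_n.

(** The standard chart of P^(n-1) where the j-th coordinate is 1. *)
Definition insert1 (w : 'rV[K]_q) : 'rV[K]_n :=
  \row_i (if unlift j i is Some i' then w 0 i' else 1).

Definition commutant_chart (y : 'rV[K]_(p + q)) : X :=
  commutant_point (lsubmx y) (insert1 (rsubmx y)).

Definition commutant_chart_dom (y : 'rV[K]_(p + q)) : K :=
  \det (krylov_comb (lsubmx y) (insert1 (rsubmx y))).

(** Inverse of [commutant_chart]: the Krylov determinant scaling [krylov_coord] cancels in the
    ratios. *)
Definition chart_coord (x : 'rV[K]_p) (v : 'rV[K]_(n * n)) : 'rV[K]_(p + q) :=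
  row_mx x (\row_i (krylov_coord x v 0 (lift j i) / krylov_coord x v 0 j)).

Lemma insert1j w : insert1 w 0 j = 1.
Proof. by rewrite mxE unlift_none. Qed.

Lemma insert1_lift w i : insert1 w 0 (lift j i) = w 0 i.
Proof. by rewrite mxE liftK. Qed.

Lemma insert1E (a : 'rV[K]_n) : a 0 j != 0 ->
  insert1 (\row_i (a 0 (lift j i) / a 0 j)) = (a 0 j)^-1 *: a.
Proof.
move=> a0; apply/rowP => i; rewrite [RHS]mxE.
have [i' ->|->] := unliftP j i; first by rewrite insert1_lift mxE mulrC.
by rewrite insert1j mulVf.
Qed.

Lemma polyfun_lsubmx i : polyfun (fun y : 'rV[K]_(p + q) => lsubmx y 0 i).
Proof.
by apply: (eq_polyfun (polyfun_coord K (lshift q i))) => y; rewrite mxE.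
Qed.

Lemma polyfun_insert1 i : polyfun (fun y : 'rV[K]_(p + q) => insert1 (rsubmx y) 0 i).
Proof.
have [i' ->|->] := unliftP j i.
  apply: (eq_polyfun (polyfun_coord K (rshift p i'))) => y.
  by rewrite insert1_lift mxE.
by apply: (eq_polyfun (polyfun_cst _ 1)) => y; rewrite insert1j.
Qed.

Lemma chart_coord_point (y : 'rV[K]_(p + q)) v : commutant_chart_dom y != 0 ->
  proj_part (set_val (commutant_chart y)) v ->
  krylov_coord (affine_part (set_val (commutant_chart y))) v 0 j != 0 /\
  chart_coord (affine_part (set_val (commutant_chart y))) v = y.
Proof.
rewrite /commutant_chart_dom -unitfE -unitmxE => u.
rewrite /commutant_chart affine_commutant_point//.
rewrite (proj_part_class (proj_commutant_point u)) => -[c /= c0 <-].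
have cE i : krylov_coord (lsubmx y) (c *: mxvec (krylov_comb (lsubmx y) (insert1 (rsubmx y)))) 0 i =
    c * \det (krylov (N (lsubmx y)) r) * insert1 (rsubmx y) 0 i.
  by rewrite krylov_coordZ krylov_combK !mxE mulrA.
split; first by rewrite cE insert1j mulr1 mulf_neq0.
rewrite /chart_coord -[RHS]hsubmxK; congr row_mx; apply/rowP => i.
rewrite mxE !cE insert1j insert1_lift mulr1 [LHS]mulrAC divff ?mul1r//.
by rewrite mulf_neq0.
Qed.

Lemma chart_coordK (z : X) v : proj_part (set_val z) v ->
  krylov_coord (affine_part (set_val z)) v 0 j != 0 ->
  commutant_chart_dom (chart_coord (affine_part (set_val z)) v) != 0 /\
  commutant_chart (chart_coord (affine_part (set_val z)) v) = z.
Proof.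
move=> zv; have [a [u E]] := commutant_rep zv; set x := affine_part _ in u E *.
rewrite {1}E krylov_combK mxE mulf_eq0 negb_or => /andP[_ aj].
have cE : \row_i (krylov_coord x v 0 (lift j i) / krylov_coord x v 0 j) =
    \row_i (a 0 (lift j i) / a 0 j).
  apply/rowP => i; rewrite [LHS]mxE [RHS]mxE E krylov_combK !mxE.
  by rewrite -mulf_div divff// mul1r.
have u' : krylov_comb x ((a 0 j)^-1 *: a) \in unitmx.
  by rewrite krylov_combZ unitmxZ// unitfE invr_eq0.
rewrite /commutant_chart_dom /commutant_chart /chart_coord row_mxKl row_mxKr cE insert1E//.
split; first by rewrite -unitfE -unitmxE.
apply/esym/commutant_point_eq => //.
rewrite (proj_part_class zv) E krylov_combZ linearZ; exists (a 0 j)^-1 => //=.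
by rewrite invr_eq0.
Qed.

(** Homogenisation: a power of the j-th Krylov coordinate clears the denominators of
    [chart_coord]. *)
Lemma bihomog_chart_coord h : polyfun h -> exists D H, bihomog D H /\
  forall x v, krylov_coord x v 0 j != 0 ->
    H x v = krylov_coord x v 0 j ^+ D * h (chart_coord x v).
Proof.
elim=> [c|i|f1 f2 _ [D1 [H1 [b1 E1]]] _ [D2 [H2 [b2 E2]]]
  |f1 f2 _ [D1 [H1 [b1 E1]]] _ [D2 [H2 [b2 E2]]]].
- exists 0%N, (fun _ _ => c); split; first exact: bihomog_cst.
  by move=> x v _; rewrite mul1r.
- case: (split_ordP i) => i' ->.
    exists 0%N, (fun x v => x 0 i'); split; first exact: bihomog_affine.
    by move=> x v _; rewrite mul1r row_mxEl.
  exists 1%N, (fun x v => krylov_coord x v 0 (lift j i')); split.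
    exact: bihomog_krylov_coord.
  by move=> x v c0; rewrite row_mxEr [(\row_i _) 0 i']mxE expr1 mulrC divfK//.
- have bj D : bihomog D (fun x v => krylov_coord x v 0 j ^+ D).
    by have := bihomogX D (bihomog_krylov_coord j); rewrite muln1.
  exists (D1 + D2)%N, (fun x v => H1 x v * krylov_coord x v 0 j ^+ D2 +
    krylov_coord x v 0 j ^+ D1 * H2 x v); split.
    by apply: bihomogD; apply: bihomogM.
  move=> x v c0; rewrite E1// E2// exprD; ring.
- exists (D1 + D2)%N, (fun x v => H1 x v * H2 x v); split; first exact: bihomogM.
  by move=> x v c0; rewrite E1// E2// exprD; ring.
Qed.

Lemma commutant_affine_chart : affine_chart commutant_chart_dom commutant_chart.
Proof.
have bj D : bihomog D (fun x v => krylov_coord x v 0 j ^+ D).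
  by have := bihomogX D (bihomog_krylov_coord j); rewrite muln1.
split.
- apply: polyfun_det; apply: polyfun_krylov_comb; [exact: polyfun_lsubmx|exact: polyfun_insert1].
- move=> y y' gy gy' E; have [v zv] := proj_part_ex (set_val (commutant_chart y)).
  have zv' := zv; rewrite E in zv'.
  have [_ h] := chart_coord_point gy zv; have [_ h'] := chart_coord_point gy' zv'.
  by rewrite -[LHS]h -[RHS]h' E.
- move=> y U gy yU.
  exact: (commutant_point_cont polyfun_lsubmx polyfun_insert1 gy yU).
- move=> h ph; have [D [H [bH EH]]] := bihomog_chart_coord ph.
  rewrite openE => _ [y [gy hy] <-].
  have [v zv] := proj_part_ex (set_val (commutant_chart y)).
  have [c0 yE] := chart_coord_point gy zv.
  (* The extra factor forces the j-th coordinate to be nonzero, that is, the point to lie in the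
     chart. *)
  apply/subvariety_nbhsP; exists (D + 1)%N, (fun x v => H x v * krylov_coord x v 0 j), v.
  split=> //.
  + by apply: bihomogM => //; exact: bihomog_krylov_coord.
  + by rewrite EH// yE !mulf_neq0// expf_neq0.
  + move=> z w zw; rewrite mulf_eq0 negb_or => /andP[+ cw].
    rewrite EH// mulf_eq0 negb_or => /andP[_ hw].
    have [gz zE] := chart_coordK zw cw.
    by exists (chart_coord (affine_part (set_val z)) w).
- move=> y f gy; split.
    move=> /regular_atP[e [F [G [v [bF bG zv Gv hf]]]]].
    pose rep y := mxvec (krylov_comb (lsubmx y) (insert1 (rsubmx y))) : 'rV[K]_(n * n).
    have prep i : polyfun (fun y => rep y 0 i).
      case/mxvec_indexP: i => i1 i2.
      apply: (eq_polyfun (polyfun_krylov_comb polyfun_lsubmx polyfun_insert1 i1 i2)) => y'.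
      by rewrite mxvecE.
    have urep y' : commutant_chart_dom y' != 0 ->
        affine_part (set_val (commutant_chart y')) = lsubmx y' /\
        proj_part (set_val (commutant_chart y')) (rep y').
      rewrite /commutant_chart_dom -unitfE -unitmxE => u.
      by split; [exact: affine_commutant_point|exact: proj_commutant_point].
    exists (fun y => F (lsubmx y) (rep y)), (fun y => G (lsubmx y) (rep y)); split.
    + exact: polyfun_bihomog polyfun_lsubmx prep bF.
    + exact: polyfun_bihomog polyfun_lsubmx prep bG.
    + have [<- py] := urep y gy; exact: bihomog_rep bG zv py Gv.
    + by move=> y' gy' Gy'; have [xE py] := urep y' gy'; rewrite (hf _ _ py) xE.
  move=> [F [G [pF pG Gy hf]]].
  have [D1 [HF [bHF EF]]] := bihomog_chart_coord pF.
  have [D2 [HG [bHG EG]]] := bihomog_chart_coord pG.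
  have [v zv] := proj_part_ex (set_val (commutant_chart y)).
  have [c0 yE] := chart_coord_point gy zv.
  (* The crossed exponents equalise the degrees and the powers of the j-th coordinate; the
     successors keep that coordinate nonzero where the denominator is. *)
  apply/regular_atP; exists (D1 + D2.+1)%N,
    (fun x v => HF x v * krylov_coord x v 0 j ^+ D2.+1),
    (fun x v => HG x v * krylov_coord x v 0 j ^+ D1.+1), v; split=> //.
  + exact: bihomogM.
  + by rewrite addnS -addSn addnC; apply: bihomogM.
  + by rewrite EG// yE !mulf_neq0// expf_neq0.
  + move=> z w zw; rewrite mulf_eq0 negb_or => /andP[+ cw'].
    have cw : krylov_coord (affine_part (set_val z)) w 0 j != 0.
      by apply: contraNneq cw' => ->; rewrite expr0n.
    rewrite EG// mulf_eq0 negb_or => /andP[_ hw].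
    have [gz zE] := chart_coordK zw cw.
    rewrite -{1}zE hf// EF//; move: cw hw.
    set c := krylov_coord _ _ _ _; set G' := G _ => c1 G1.
    by rewrite !exprS; field; rewrite G1 c1 !expf_neq0.
Qed.

End Chart.

Lemma commutant_chart_at (z : X) : exists j y,
  commutant_chart_dom j y != 0 /\ z = commutant_chart j y.
Proof.
have [v zv] := proj_part_ex (set_val z).
have [a [u E]] := commutant_rep zv.
have [j aj] : exists j, a 0 j != 0.
  apply/rV0Pn; apply: contraTneq u => ->.
  by rewrite /krylov_comb big1 ?unitmxE ?det0 ?unitr0// => i _; rewrite mxE scale0r.
have [|gz zE] := @chart_coordK j z v zv.
  by rewrite E krylov_combK mxE mulf_neq0.
by exists j, (chart_coord j (affine_part (set_val z)) v).
Qed.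

Lemma commutant_local_dim (z : X) : local_dim z (p + q).
Proof.
have [j [y [gy ->]]] := commutant_chart_at z.
exact: (chart_local_dim (commutant_affine_chart j) gy).
Qed.

Lemma commutant_smooth : smooth X.
Proof.
move=> z; have [j [y [gy ->]]] := commutant_chart_at z.
exact: (chart_smooth_at (commutant_affine_chart j) gy).
Qed.

Lemma commutant_krull_dim : krull_dim X (p + q).
Proof.
apply: krull_dim_local commutant_local_dim.
exact: (commutant_point 0 0).
Qed.

(** With [a] left unnormalised, a single principal open set of A^(p+n) maps onto the whole space,
    which is therefore irreducible. *)
Lemma commutant_connected : connected [set: X].
Proof.
pose A (y : 'rV[K]_(p + n)) := lsubmx y; pose B (y : 'rV[K]_(p + n)) := rsubmx y.
have hA i : polyfun (fun y => A y 0 i).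
  by apply: (eq_polyfun (polyfun_coord K (lshift n i))) => y; rewrite mxE.
have hB i : polyfun (fun y => B y 0 i).
  by apply: (eq_polyfun (polyfun_coord K (rshift p i))) => y; rewrite mxE.
pose g y := \det (krylov_comb (A y) (B y)).
pose psi y := commutant_point (A y) (B y).
pose S := [set y | setT y /\ g y != 0].
have ST z : exists2 y, S y & psi y = z.
  have [x [a [u ->]]] := commutant_point_surj z.
  exists (row_mx x a); last by rewrite /psi /A /B row_mxKl row_mxKr.
  by split=> //; rewrite /g /A /B row_mxKl row_mxKr -unitfE -unitmxE.
have -> : [set: X] = closure (psi @` S).
  by apply/seteqP; split=> // z _; apply: subset_closure; exact: ST.
apply: irreducible_connected; apply: (@irreducible_closure_image _ _ _ setT g) => //.
- by apply: polyfun_det; exact: polyfun_krylov_comb.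
- move=> y U [_ gy] /(commutant_point_cont hA hB gy)[h [ph hy hU]].
  by exists h; split=> // y' [_ gy']; exact: hU.
- by have [y Sy _] := ST (commutant_point 0 0); exists y.
Qed.

(** Invertibility is the non-vanishing of a form of degree n in [v]; commutation is a system of
    equations linear in [v] with coefficients polynomial in [x]. *)
Lemma commutant_locally_closed : locally_closed commutant_set.
Proof.
pose U := [set z : affproj K p (n * n) | exists2 v, proj_part z v & \det (vec_mx v : 'M_n) != 0].
pose c (x : 'rV[K]_p) (v : 'rV[K]_(n * n)) (i j : 'I_n) := \sum_l v 0 (mxvec_index i l) * N x l j +
  (-1) * \sum_l N x i l * v 0 (mxvec_index l j).
have cE x v i j : c x v i j = (vec_mx v *m N x - N x *m vec_mx v) i j.
  rewrite /c !mxE mulN1r; congr (_ - _); apply: eq_bigr => l _; by rewrite [vec_mx _ _ _]mxE.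
pose Q := \bigcup_(ij : 'I_n * 'I_n) [set z : affproj K p (n * n) |
  exists2 v, proj_part z v & c (affine_part z) v ij.1 ij.2 != 0].
exists U, (~` Q); split.
- apply: (@open_nonvanishing _ _ _ n (fun _ v => \det (vec_mx v))).
  apply: (@bihomog_det _ _ _ _ (fun _ v => vec_mx v)) => i j.
  by apply: (eq_bihomog (bihomog_proj K p (mxvec_index i j))) => x v; rewrite mxE.
- apply: open_closedC; apply: bigcup_open => -[i j] _ /=.
  apply: (@open_nonvanishing _ _ _ 1 (fun x v => c x v i j)).
  apply: bihomogD.
    apply: bihomog_sum => l _; apply: (@bihomogM _ _ _ 1 0); first exact: bihomog_proj.
    exact: bihomog_polyfun.
  apply: (@bihomogM _ _ _ 0 1); first exact: bihomog_cst.
  apply: bihomog_sum => l _; apply: (@bihomogM _ _ _ 0 1); last exact: bihomog_proj.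
  exact: bihomog_polyfun.
- apply/seteqP; split=> z.
    move=> [M [MU zM MN]]; split.
      exists (mxvec M); first by rewrite zM; exact: scaling_class_id.
      by rewrite mxvecK -unitfE -unitmxE.
    move=> [[i j] _ [v]]; rewrite zM => -[a /= a0 <-].
    rewrite cE linearZ/= mxvecK -scalemxAl -scalemxAr MN subrr mxE.
    by rewrite eqxx.
  move=> [[v zv dv] nQ]; exists (vec_mx v); split.
  + by rewrite unitmxE unitfE.
  + by rewrite vec_mxK; exact: proj_part_class.
  + apply/eqP; rewrite -subr_eq0; apply/eqP/matrixP => i j; rewrite [RHS]mxE -cE.
    apply/eqP; apply: contraT => ne; case: nQ; exists (i, j) => //; by exists v.
Qed.

Lemma commutant_quasi_projective : quasi_projective X.
Proof.
exact: (@locally_closed_quasi_projective K p (q + q * n) commutant_set commutant_locally_closed).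
Qed.

End CommutantSpace.

(** * The monodromy space *)

Lemma polyfun_mon_infty (R : realType) (n : nat) (tau : R[i]) (i j : 'I_n) :
  polyfun (fun x => mon_infty tau x i j).
Proof.
have entry p : polyfun (fun x => @stokes_entry R n tau x p).
  rewrite /stokes_entry; case: insub => [k|]; first exact: polyfun_coord.
  exact: polyfun_cst.
have stokes d a b : polyfun (fun x => @stokes_matrix R n tau d x a b).
  apply: (@eq_polyfun _ _ (fun x => (1%:M : 'M[R[i]]_n) a b +
    \sum_(p | `[< singular_dir tau d p >])
       stokes_entry tau x p * (delta_mx p.2 p.1 : 'M[R[i]]_n) a b)); last first.
    by move=> x; rewrite [RHS]mxE summxE; congr (_ + _); apply: eq_bigr => p _; rewrite [RHS]mxE.
  apply: polyfunD; first exact: polyfun_cst.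
  by apply: polyfun_sum => p _; apply: polyfunM => //; exact: polyfun_cst.
apply: polyfun_mulmx => [a b|a b]; first exact: polyfun_cst.
elim: (rev _) a b => [|d l IH] a b.
  by apply: (eq_polyfun (polyfun_cst _ ((1%:M : 'M[R[i]]_n) a b))) => x; rewrite big_nil.
apply: (eq_polyfun (polyfun_mulmx (stokes d) IH a b)) => x.
by rewrite big_cons.
Qed.

Theorem mainTheorem3 (R : realType) (n : nat) (hn : (2 <= n)%N)
    (tau : R[i]) (htau : tau != 0) :
  [/\ smooth (monodromy_space n tau),
      connected [set: monodromy_space n tau],
      quasi_projective (monodromy_space n tau) &
      krull_dim (monodromy_space n tau) (2 * (n - 1))%N].
Proof.
case: n hn => [|[|m]] // _.
have [r hr] := mon_infty_cyclic m htau.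
have poly := @polyfun_mon_infty R m.+2 tau.
have -> : (2 * (m.+2 - 1) = m.+1 + m.+1)%N by rewrite subn1 mul2n addnn.
(* [monodromy_set] unfolds to the [commutant_set] of [mon_infty], with p = q = n - 1. *)
split.
- exact: (commutant_smooth poly hr).
- exact: (commutant_connected poly hr).
- exact: (commutant_quasi_projective poly).
- exact: (commutant_krull_dim poly hr).
Qed.
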